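(* (i) Let $h\in\mathcal{H}(n)$ and $1\le d_0<d<n$ be such that $h(d)=h(d+1)$ and $h^{-1}(d)=\{d_0\}$, and define $h_-,h_+$ by $h_-(d_0)=d-1$, $h_+(d_0)=d+1$ and $h_\pm(j)=h(j)$ for $j\ne d_0$. Put $\mathcal{G}_-=\mathcal{G}_X(h_-)$, $\mathcal{G}=\mathcal{G}_X(h)$, $\mathcal{G}_+=\mathcal{G}_X(h_+)$. Then there is an isomorphism $$H^*(\mathcal{G})\oplus H^{*-2}(\mathcal{G})\cong H^*(\mathcal{G}_+)\oplus H^{*-2}(\mathcal{G}_-)$$ of graded $\mathfrak{S}_n$-modules. (ii) Consequently $H^*(X(h))$ satisfies the modular law: the function $F(h)=\sum_{i\ge0}\mathrm{ch}\left(H^{2i}(X(h))\right)q^i$ on $\mathcal{H}(n)$ satisfies $(1+q)F(h)=F(h_+)+qF(h_-)$ for every modular triple $(h_-,h,h_+)$.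
   Context: Let $[n]=\{1,\dots,n\}$ and $\mathfrak{S}_n$ the symmetric group on $[n]$. A Hessenberg function is a non-decreasing map $h\colon[n]\to[n]$ with $h(j)\ge j$ for all $j$; $\mathcal{H}(n)$ is the set of them. Modular triples: $(h_-,h,h_+)$ in $\mathcal{H}(n)$ is a modular triple if one of the following holds. (C) $h(d)=h(d+1)$ and $h^{-1}(d)=\{d_0\}$ for some $1\le d_0<d<n$, and $h_-(d_0)=d-1$, $h_+(d_0)=d+1$, $h_\pm(j)=h(j)$ for $j\ne d_0$. (R) $h(d')+1=h(d'+1)\ne d'+1$ and $h^{-1}(d')=\emptyset$ for some $1\le d'<n$, and $h_-(d'+1)=h(d')$, $h_-(j)=h(j)$ for $j\ne d'+1$, $h_+(d')=h(d')+1$, $h_+(j)=h(j)$ for $j\ne d'$. All cohomology is with $\mathbb{C}$ coefficients. Put $H^*(BT)=\mathbb{C}[t_1,\dots,t_n]$ with $\deg t_i=2$, where $T=(S^1)^n$; $\sigma\in\mathfrak{S}_n$ acts on it by $t_i\mapsto t_{\sigma(i)}$. For $k\in\mathcal{H}(n)$, $\mathcal{G}_X(k)$ is the labeled graph with vertex set $\mathfrak{S}_n$, edges $\{w,w(i,j)\}$ for $w\in\mathfrak{S}_n$, $j<i\le k(j)$ ($(i,j)$ is a transposition), and label $t_{w(i)}-t_{w(j)}$ on $\{w,w(i,j)\}$. Its equivariant graph cohomology is $$H^*_T(\mathcal{G}_X(k))=\{f\colon\mathfrak{S}_n\to H^*(BT)\mid f(w)\equiv f(w(i,j))\ (\mathrm{mod}\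 t_{w(i)}-t_{w(j)})\ \text{for all } w\in\mathfrak{S}_n,\ j<i\le k(j)\},$$ graded by degree, and $H^*(\mathcal{G}_X(k))=H^*_T(\mathcal{G}_X(k))/(t_1,\dots,t_n)$, where $t_i$ is regarded as a constant map. $H^{*-2}$ denotes the degree shift by $2$. The dot action $(\sigma\cdot f)(w)=\sigma(f(\sigma^{-1}w))$ preserves $H^*_T(\mathcal{G}_X(k))$ and the ideal $(t_1,\dots,t_n)$ and descends to $H^*(\mathcal{G}_X(k))$, making it a graded $\mathfrak{S}_n$-module. The regular semisimple Hessenberg variety is $X(h)=\{V_\bullet=(V_1\subset\cdots\subset V_n=\mathbb{C}^n)\in\mathrm{Fl}(n)\mid SV_i\subset V_{h(i)}\text{ for } i\in[n]\}$, where $S$ is a diagonal matrix with distinct real eigenvalues and $\mathrm{Fl}(n)$ is the variety of complete flags in $\mathbb{C}^n$. The torus $T$ acts on $X(h)$ via its coordinatewise action on $\mathbb{C}^n$, with fixed point set the permutation flags $V_\bullet(w)$, $V_i(w)=\langle\mathbf{e}_{w(1)},\dots,\mathbf{e}_{w(i)}\rangle$, identified with $\mathfrak{S}_n$. $H^*(X(h))$ is concentrated in even degrees, and restriction to fixed points gives an isomorphism $H^*_T(X(h))\cong H^*_T(\mathcal{G}_X(h))$ inducing $H^*(X(h))\cong H^*(\mathcal{G}_X(h))$; the $\mathfrak{S}_n$-module structure on $H^{*}(X(h))$ is the dot action transported along this isomorphism. $\mathrm{ch}$ is the Frobenius characteristic from finite-dimensional $\mathfrak{S}_n$-modules to symmetric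 functions of degree $n$ in $z_1,z_2,\dots$. *)

(* Defs.v *)
From HB Require Import structures.
From mathcomp Require Import all_boot all_order all_algebra all_fingroup.
From mathcomp Require Import mpoly.
From mathcomp.real_closed Require Import complex.
From mathcomp Require Import boolp classical_sets functions.
From mathcomp Require Import reals topology.

Set Implicit Arguments.
Unset Strict Implicit.
Unset Printing Implicit Defensive.

Import Order.TTheory GRing.Theory Num.Theory.
Local Open Scope ring_scope.

Section Subquotient.
Variables (K : nzRingType) (U : lmodType K).

Record sub_of (Z : submodClosed U) := SubOf { sub_val : U; _ : sub_val \in Z }.

Section Sub.
Variable Z : submodClosed U.
HB.instance Definition _ := [isSub for @sub_val Z].
HB.instance Definition _ := [Choice of sub_of Z by <:].
HB.instance Definition _ := [SubChoice_isSubLmodule of sub_of Z by <:].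

Lemma sub_val_linear : linear (@sub_val Z).
Proof. exact: (linearP (val : {linear sub_of Z -> U})). Qed.

Lemma sub_val0 : sub_val (0 : sub_of Z) = 0.
Proof. exact: (raddf0 (val : {linear sub_of Z -> U})). Qed.

Lemma sub_valB (x y : sub_of Z) : sub_val (x - y) = sub_val x - sub_val y.
Proof. exact: (raddfB (val : {linear sub_of Z -> U})). Qed.

Lemma sub_valZ a (x : sub_of Z) : sub_val (a *: x) = a *: sub_val x.
Proof. by have := sub_val_linear a x 0; rewrite sub_val0 !addr0. Qed.
End Sub.

Variables Z B : submodClosed U.

Definition restr_pred : {pred sub_of Z} := fun x => sub_val x \in B.

Fact restr_submod_closed : submod_closed restr_pred.
Proof.
have restrE x : (x \in restr_pred) = (sub_val x \in B) by [].
split=> [|a x y]; rewrite !restrE; first by rewrite sub_val0 rpred0.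
by move=> xB yB; rewrite sub_val_linear rpredD ?rpredZ.
Qed.
HB.instance Definition _ :=
  GRing.isSubmodClosed.Build K (sub_of Z) restr_pred restr_submod_closed.

(* Z / (Z :&: B) *)
Definition subquot := Quotient.quot (restr_pred : zmodClosed (sub_of Z)).
HB.instance Definition _ := GRing.Zmodule.on subquot.

Definition subquot_pi (x : sub_of Z) : subquot := (\pi x)%qT.

Lemma subquot_piP x y : subquot_pi x = subquot_pi y <-> sub_val x - sub_val y \in B.
Proof.
rewrite /subquot_pi; split=> [/eqP|xyB]; last apply/eqP;
  by rewrite -Quotient.idealrBE unfold_in /restr_pred sub_valB.
Qed.

Lemma subquot_piK (x : subquot) : subquot_pi (generic_quotient.repr x) = x.
Proof. exact: reprK. Qed.

Lemma subquot_piD x y : subquot_pi (x + y) = subquot_pi x + subquot_pi y.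
Proof. by rewrite /subquot_pi !piE. Qed.

Definition subquot_scale (a : K) (x : subquot) : subquot :=
  subquot_pi (a *: generic_quotient.repr x).

Fact subquot_scale_pi a x : subquot_scale a (subquot_pi x) = subquot_pi (a *: x).
Proof.
apply/subquot_piP; rewrite !sub_valZ -scalerBr rpredZ //.
by apply/subquot_piP; rewrite subquot_piK.
Qed.

Fact subquot_scaleA a b x :
  subquot_scale a (subquot_scale b x) = subquot_scale (a * b) x.
Proof. by rewrite -[x]subquot_piK !subquot_scale_pi scalerA. Qed.

Fact subquot_scale1 : left_id 1 subquot_scale.
Proof. by move=> x; rewrite -[x]subquot_piK subquot_scale_pi scale1r. Qed.

Fact subquot_scaleDr : right_distributive subquot_scale +%R.
Proof.
move=> a x y; rewrite -[x]subquot_piK -[y]subquot_piK.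
by rewrite -subquot_piD !subquot_scale_pi scalerDr subquot_piD.
Qed.

Fact subquot_scaleDl x : {morph subquot_scale^~ x : a b / a + b}.
Proof.
move=> a b; rewrite -[x]subquot_piK !subquot_scale_pi.
by rewrite scalerDl subquot_piD.
Qed.

HB.instance Definition _ := GRing.Zmodule_isLmodule.Build K subquot
  subquot_scaleA subquot_scale1 subquot_scaleDr subquot_scaleDl.

Lemma subquot_piZ a x : subquot_pi (a *: x) = a *: subquot_pi x.
Proof. by rewrite -subquot_scale_pi. Qed.

Section Map.
Variable g : {linear U -> U}.
Hypothesis gZ : forall x, x \in Z -> g x \in Z.
Hypothesis gB : forall x, x \in B -> g x \in B.

Definition sub_map (x : sub_of Z) : sub_of Z := @SubOf Z (g (sub_val x)) (gZ (valP x)).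

Definition subquot_map (x : subquot) : subquot := subquot_pi (sub_map (generic_quotient.repr x)).

Lemma subquot_map_pi x : subquot_map (subquot_pi x) = subquot_pi (sub_map x).
Proof.
apply/subquot_piP; rewrite /= -raddfB gB //.
by apply/subquot_piP; rewrite subquot_piK.
Qed.

Lemma subquot_map_linear : linear subquot_map.
Proof.
move=> a x y; rewrite -[x]subquot_piK -[y]subquot_piK.
rewrite -subquot_piZ -subquot_piD !subquot_map_pi -subquot_piZ -subquot_piD.
congr subquot_pi; apply: val_inj.
by rewrite [RHS]sub_val_linear -[LHS]/(g _) sub_val_linear linearP.
Qed.
End Map.

End Subquotient.

(* Permutations are functions on 'I_n (read {1..n} as {0..n-1}) and S_n acts on
   the left for composition of functions; in MathComp (s * t)%g is s followed by
   t, i.e. t \o s, whence the order in [sn_actM]. *)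
Record sn_module (K : nzRingType) (n : nat) := SnModule {
  sn_sort :> lmodType K;
  sn_act : 'S_n -> sn_sort -> sn_sort;
  sn_act_linear : forall s, linear (sn_act s);
  sn_act1 : forall x, sn_act 1%g x = x;
  sn_actM : forall s t x, sn_act (s * t)%g x = sn_act t (sn_act s x) }.

Definition graded_sn_module (K : nzRingType) (n : nat) := nat -> sn_module K n.

Record lin_iso (K : nzRingType) (V W : lmodType K) := LinIso {
  lin_iso_fun :> {linear V -> W};
  lin_iso_inv : W -> V;
  lin_isoK : cancel lin_iso_fun lin_iso_inv;
  lin_iso_invK : cancel lin_iso_inv lin_iso_fun }.

Definition graded_iso (K : nzRingType) (n : nat) (A B : graded_sn_module K n) :=
  exists phi : forall m, lin_iso (A m) (B m),
    forall m (s : 'S_n) (x : A m), phi m (sn_act s x) = sn_act s (phi m x).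

Section Constructions.
Variables (K : nzRingType) (n : nat).

Section Sum.
Variables V W : sn_module K n.
Let act (s : 'S_n) (x : V * W) : V * W := (sn_act s x.1, sn_act s x.2).

Fact sum_act_linear s : linear (act s).
Proof. by move=> a x y; rewrite /act /= !sn_act_linear. Qed.

Fact sum_act1 x : act 1%g x = x.
Proof. by case: x => x y; rewrite /act /= !sn_act1. Qed.

Fact sum_actM s t x : act (s * t)%g x = act t (act s x).
Proof. by rewrite /act /= !sn_actM. Qed.

Definition sn_sum := SnModule sum_act_linear sum_act1 sum_actM.
End Sum.

Fact zero_act_linear (s : 'S_n) : linear (id : 'rV[K]_0 -> 'rV[K]_0).
Proof. by []. Qed.

Definition sn_zero : sn_module K n :=
  @SnModule K n 'rV[K]_0 (fun _ x => x) zero_act_linear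
    (fun _ => erefl) (fun _ _ _ => erefl).

Definition graded_sum (A B : graded_sn_module K n) : graded_sn_module K n :=
  fun m => sn_sum (A m) (B m).

(* A^{* - 2} *)
Definition graded_shift2 (A : graded_sn_module K n) : graded_sn_module K n :=
  fun m => if m is m'.+2 then A m' else sn_zero.

Section Transport.
Variables (V : lmodType K) (W : sn_module K n) (phi : lin_iso V W).
Let act (s : 'S_n) (x : V) : V := lin_iso_inv phi (sn_act s (phi x)).

Fact transport_act_linear s : linear (act s).
Proof.
move=> a x y; apply: (can_inj (lin_isoK phi)).
by rewrite linearP !lin_iso_invK linearP sn_act_linear.
Qed.

Fact transport_act1 x : act 1%g x = x.
Proof. by rewrite /act sn_act1 lin_isoK. Qed.

Fact transport_actM s t x : act (s * t)%g x = act t (act s x).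
Proof. by rewrite /act sn_actM lin_iso_invK. Qed.

Definition sn_transport :=
  SnModule transport_act_linear transport_act1 transport_actM.
End Transport.

Definition graded_transport (V : nat -> lmodType K) (W : graded_sn_module K n)
    (phi : forall m, lin_iso (V m) (W m)) : graded_sn_module K n :=
  fun m => sn_transport (phi m).

End Constructions.

(* [n] = {1, .., n} is 'I_n = {0, .., n-1}: indices and values are shifted by 1 *)
Record hessenberg (n : nat) := Hessenberg {
  hess_fun :> 'I_n -> 'I_n;
  hess_homo : forall i j : 'I_n, (i <= j)%N -> (hess_fun i <= hess_fun j)%N;
  hess_ge : forall j : 'I_n, (j <= hess_fun j)%N }.

(* d1 stands for d + 1 and thereby encodes d < n *)
Definition triple_C_at n (hm h hp : 'I_n -> 'I_n) (d0 d d1 : 'I_n) : Prop :=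
  [/\ (d0 < d)%N /\ d1 = d.+1 :> nat,
      h d = h d1 /\ (forall j, h j = d <-> j = d0),
      hm d0 = d.-1 :> nat, hp d0 = d1
    & forall j, j != d0 -> hm j = h j /\ hp j = h j].

(* d1 stands for d' + 1 *)
Definition triple_R_at n (hm h hp : 'I_n -> 'I_n) (d d1 : 'I_n) : Prop :=
  [/\ d1 = d.+1 :> nat,
      (h d).+1 = h d1 :> nat /\ h d1 <> d1,
      forall j, h j <> d,
      hm d1 = h d /\ (forall j, j != d1 -> hm j = h j)
    & hp d = (h d).+1 :> nat /\ (forall j, j != d -> hp j = h j)].

Definition modular_triple n (hm h hp : hessenberg n) : Prop :=
  (exists d0 d d1 : 'I_n, triple_C_at hm h hp d0 d d1) \/
  (exists d d1 : 'I_n, triple_R_at hm h hp d d1).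

Section GraphCohomology.
Variables (K : fieldType) (n : nat).

Local Notation HBT := {mpoly K[n]}.
Local Notation F := {ffun 'S_n -> HBT}.

(* cohomological degree of a monomial: deg t_i = 2 *)
Definition cohdeg (m : 'X_{1..n}) : nat := (2 * mdeg m)%N.

Fact cohdeg0 : cohdeg 0%MM = 0%N.
Proof. by rewrite /cohdeg mdeg0. Qed.

Fact cohdegD : {morph cohdeg : m1 m2 / (m1 + m2)%MM >-> (m1 + m2)%N}.
Proof. by move=> m1 m2; rewrite /cohdeg mdegD mulnDr. Qed.

HB.instance Definition _ := isMeasure.Build n cohdeg cohdeg0 cohdegD.

Section Module.
Variable k : 'I_n -> 'I_n.

(* w (i, j) is w \o tperm i j, written tperm i j * w in MathComp *)
Definition in_HT (f : F) : Prop :=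
  forall (w : 'S_n) (i j : 'I_n), (j < i)%N -> (i <= k j)%N ->
    exists g : HBT, f w - f (tperm i j * w)%g = ('X_(w i) - 'X_(w j)) * g.

(* the ideal (t_1, .., t_n) of H_T *)
Definition in_ideal (f : F) : Prop :=
  exists2 g : 'I_n -> F, (forall i, in_HT (g i))
    & forall w, f w = \sum_(i < n) 'X_i * g i w.

Definition HT_pred (m : nat) : {pred F} :=
  fun f => `[< in_HT f /\ (forall w, f w \is m.-homog for cohdeg) >].

Definition ideal_pred : {pred F} := fun f => `[< in_ideal f >].

Lemma in_HT0 : in_HT 0.
Proof. by move=> w i j _ _; exists 0; rewrite !ffunE subr0 mulr0. Qed.

Lemma in_HT_lin a f g : in_HT f -> in_HT g -> in_HT (a *: f + g).
Proof.
move=> Hf Hg w i j ji ijk.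
have [p pE] := Hf w i j ji ijk; have [q qE] := Hg w i j ji ijk.
exists (a *: p + q); rewrite !ffunE mulrDr -scalerAr -pE -qE.
by rewrite scalerBr addrACA opprD.
Qed.

Fact HT_submod_closed m : submod_closed (HT_pred m).
Proof.
split=> [|a f g].
  by apply/asboolP; split=> [|w]; [exact: in_HT0|rewrite ffunE rpred0].
move=> /asboolP[Hf hf] /asboolP[Hg hg]; apply/asboolP; split.
  exact: in_HT_lin.
by move=> w; rewrite !ffunE rpredD ?rpredZ.
Qed.
HB.instance Definition _ m :=
  GRing.isSubmodClosed.Build K F (HT_pred m) (HT_submod_closed m).

Fact ideal_submod_closed : submod_closed ideal_pred.
Proof.
split=> [|a f g].
  apply/asboolP; exists (fun=> 0) => [_|w]; first exact: in_HT0.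
  by rewrite big1 => [|i _]; rewrite !ffunE ?mulr0.
move=> /asboolP[f' Hf fE] /asboolP[g' Hg gE]; apply/asboolP.
exists (fun i => a *: f' i + g' i) => [i|w]; first exact: in_HT_lin.
rewrite !ffunE fE gE scaler_sumr -big_split /=; apply: eq_bigr => i _.
by rewrite !ffunE mulrDr scalerAr.
Qed.
HB.instance Definition _ :=
  GRing.isSubmodClosed.Build K F ideal_pred ideal_submod_closed.

(* (s . f)(w) = s (f (s^-1 w)), where s^-1 w is w * s^-1 in MathComp *)
Definition dot (s : 'S_n) (f : F) : F := [ffun w => msym s (f (w * s^-1)%g)].

Fact dot_linear s : linear (dot s).
Proof. by move=> a f g; apply/ffunP=> w; rewrite !ffunE linearP. Qed.
HB.instance Definition _ s :=
  GRing.isLinear.Build K F F *:%R (dot s) (dot_linear s).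

Lemma msymXU (s : 'S_n) (i : 'I_n) : msym s 'X_i = 'X_(s i) :> HBT.
Proof. by rewrite /msym mmapX mmap1U. Qed.

Lemma dot_HT s f : in_HT f -> in_HT (dot s f).
Proof.
move=> Hf w i j ji ijk; have [g gE] := Hf (w * s^-1)%g i j ji ijk.
exists (msym s g); rewrite !ffunE -mulgA -msymB gE msymM msymB !msymXU.
by rewrite !permM !permKV.
Qed.

Lemma dot_HT_pred m s f : f \in HT_pred m -> dot s f \in HT_pred m.
Proof.
move=> /asboolP[Hf hf]; apply/asboolP; split; first exact: dot_HT.
move=> w; rewrite ffunE; apply/dhomogP=> mm.
rewrite mcoeff_msupp mcoeff_sym -mcoeff_msupp => /(dhomog_mf (hf _)) <-.
by rewrite /= /cohdeg mdeg_mperm.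
Qed.

Lemma dot_ideal s f : f \in ideal_pred -> dot s f \in ideal_pred.
Proof.
move=> /asboolP[g Hg fE]; apply/asboolP.
exists (fun i => dot s (g ((s^-1)%g i))) => [i|w]; first exact: dot_HT.
rewrite ffunE fE raddf_sum /= [RHS](reindex_perm s) /=; apply: eq_bigr => i _.
by rewrite !ffunE msymM msymXU permK.
Qed.

Section Degree.
Variable m : nat.

Definition HG_act (s : 'S_n) (x : subquot (HT_pred m) ideal_pred) :
    subquot (HT_pred m) ideal_pred :=
  subquot_map (@dot_HT_pred m s) x.

Fact HG_act_linear s : linear (HG_act s).
Proof. by move=> a x y; apply: (subquot_map_linear _ (@dot_ideal s)). Qed.

Fact HG_act1 x : HG_act 1%g x = x.
Proof.
rewrite -[x]subquot_piK /HG_act (subquot_map_pi _ (@dot_ideal _)); congr subquot_pi; apply: val_inj.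
by apply/ffunP=> w; rewrite !ffunE msym1m invg1 mulg1.
Qed.

Fact HG_actM s t x : HG_act (s * t)%g x = HG_act t (HG_act s x).
Proof.
have act_pi r y : HG_act r (subquot_pi _ y) =
    subquot_pi _ (sub_map (@dot_HT_pred m r) y).
  exact: (subquot_map_pi _ (@dot_ideal r)).
rewrite -[x]subquot_piK !act_pi; apply: congr1.
apply: val_inj; apply/ffunP=> w.
by rewrite !ffunE msymMm invMg mulgA.
Qed.

Definition HG_degree := SnModule HG_act_linear HG_act1 HG_actM.
End Degree.

(* H^*(G_X(k)); the piece of degree m is the image of the piece of H_T *)
Definition HG : graded_sn_module K n := HG_degree.
End Module.
End GraphCohomology.

(* A symmetric function of degree n in z_0, z_1, .. is the compatible family of
   its truncations f N (z_0, .., z_(N-1)): an element of the inverse limit of the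
   spaces of symmetric polynomials of degree n in N variables. *)
Definition poly_family (K : fieldType) : Type := forall N : nat, {mpoly K[N]}.

Section PolyFamily.
Variable K : fieldType.
Implicit Types f g : poly_family K.

Definition pfam_add f g : poly_family K := fun N => f N + g N.
Definition pfam_opp f : poly_family K := fun N => - f N.
Definition pfam_zero : poly_family K := fun N => 0.
Definition pfam_scale (a : K) f : poly_family K := fun N => a *: f N.

Lemma pfam_ext f g : (forall N, f N = g N) -> f = g.
Proof. exact: functional_extensionality_dep. Qed.

HB.instance Definition _ := gen_eqMixin (poly_family K).
HB.instance Definition _ := gen_choiceMixin (poly_family K).

Fact pfam_addA : associative pfam_add.
Proof. by move=> f g h; apply: pfam_ext => N; apply: addrA. Qed.
Fact pfam_addC : commutative pfam_add.
Proof. by move=> f g; apply: pfam_ext => N; apply: addrC. Qed.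
Fact pfam_add0 : left_id pfam_zero pfam_add.
Proof. by move=> f; apply: pfam_ext => N; apply: add0r. Qed.
Fact pfam_addN : left_inverse pfam_zero pfam_opp pfam_add.
Proof. by move=> f; apply: pfam_ext => N; apply: addNr. Qed.
HB.instance Definition _ := GRing.isZmodule.Build (poly_family K)
  pfam_addA pfam_addC pfam_add0 pfam_addN.

Fact pfam_scaleA a b f : pfam_scale a (pfam_scale b f) = pfam_scale (a * b) f.
Proof. by apply: pfam_ext => N; apply: scalerA. Qed.
Fact pfam_scale1 : left_id 1 pfam_scale.
Proof. by move=> f; apply: pfam_ext => N; apply: scale1r. Qed.
Fact pfam_scaleDr : right_distributive pfam_scale +%R.
Proof. by move=> a f g; apply: pfam_ext => N; apply: scalerDr. Qed.
Fact pfam_scaleDl f : {morph pfam_scale^~ f : a b / a + b}.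
Proof. by move=> a b; apply: pfam_ext => N; apply: scalerDl. Qed.
HB.instance Definition _ := GRing.Zmodule_isLmodule.Build K (poly_family K)
  pfam_scaleA pfam_scale1 pfam_scaleDr pfam_scaleDl.

(* p (z_0, .., z_(N-1), 0) *)
Definition last_to0 N (p : {mpoly K[N.+1]}) : {mpoly K[N]} :=
  p \mPo [tuple (if unlift ord_max i is Some j then 'X_j else 0) | i < N.+1].

Definition symfun_pred (n : nat) : {pred poly_family K} := fun f =>
  `[< [/\ forall N, f N \is symmetric, forall N, f N \is n.-homog
       & forall N, last_to0 (f N.+1) = f N] >].

Fact symfun_submod_closed n : submod_closed (symfun_pred n).
Proof.
have last0_lin N a (p q : {mpoly K[N.+1]}) :
    last_to0 (a *: p + q) = a *: last_to0 p + last_to0 q.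
  by rewrite /last_to0 comp_mpolyD comp_mpolyZ.
split=> [|a f g].
  apply/asboolP; split=> N; [exact: rpred0|exact: rpred0|exact: comp_mpoly0].
move=> /asboolP[fS fh fC] /asboolP[gS gh gC]; apply/asboolP.
have pE N : (a *: f + g) N = a *: f N + g N by [].
split=> N; rewrite !pE.
- by apply: rpredD; [apply: rpredZ; apply: fS|apply: gS].
- by apply: rpredD; [apply: rpredZ; apply: fh|apply: gh].
- by rewrite last0_lin fC gC.
Qed.
HB.instance Definition _ n :=
  GRing.isSubmodClosed.Build K (poly_family K) (symfun_pred n)
    (symfun_submod_closed n).

Definition symfun (n : nat) := sub_of (symfun_pred n).
HB.instance Definition _ n := GRing.Lmodule.on (symfun n).

Definition power_sum (k : nat) : poly_family K := fun N => \sum_(i < N) 'X_i ^+ k.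

(* p_lambda for lambda the cycle type of w *)
Definition cycle_power_sum n (w : 'S_n) : poly_family K :=
  fun N => \prod_(c in porbits w) power_sum #|c| N.

Lemma cycle_power_sum_symfun n (w : 'S_n) : cycle_power_sum w \in symfun_pred n.
Proof.
apply/asboolP; split=> N.
- apply/issymP=> s; rewrite /cycle_power_sum rmorph_prod /=.
  apply: eq_bigr => c _; rewrite /power_sum raddf_sum /=.
  rewrite [RHS](reindex_perm s) /=; apply: eq_bigr => i _.
  by rewrite rmorphXn /= msymXU.
- have nE : n = (\sum_(c in porbits w) #|c|)%N.
    rewrite -[LHS]card_ord -sum1_card.
    rewrite (partition_big (porbit w) (mem (porbits w))) /=.
      apply: eq_bigr => _ /imsetP[x _ ->]; rewrite sum1_card.
      by apply: eq_card => y; rewrite -eq_porbit_mem.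
    by move=> i _; apply: imset_f.
  rewrite [in X in X.-homog]nE /cycle_power_sum.
  elim/big_rec2: _ => [|c p d _ pd]; first exact: dhomog1.
  apply: dhomogM => //; rewrite /power_sum rpred_sum // => i _.
  have X1 : ('X_i : {mpoly K[N]}) \is 1.-homog by rewrite dhomogX /= mdeg1.
  by have := dhomogMn #|c| X1; rewrite mul1n.
- rewrite /last_to0 /cycle_power_sum rmorph_prod /=.
  apply: eq_bigr => c cP; rewrite /power_sum raddf_sum /= big_ord_recr /=.
  have c0 : #|c| != 0%N by case/imsetP: cP => x _ ->; apply: card_porbit_neq0.
  have XnE i : 'X_i ^+ #|c| \mPo
      [tuple (if unlift ord_max j is Some j' then 'X_j' else 0) | j < N.+1]
    = (if unlift ord_max i is Some j' then 'X_j' else 0) ^+ #|c| :> {mpoly K[N]}.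
    by rewrite rmorphXn /= comp_mpolyXU -tnth_nth tnth_mktuple.
  rewrite !XnE unlift_none expr0n (negPf c0) addr0; apply: eq_bigr => i _.
  have -> : widen_ord (leqnSn N) i = lift ord_max i.
    by apply: val_inj; rewrite /= /bump leqNgt ltn_ord.
  by rewrite XnE liftK.
Qed.

(* The trace of a linear endomorphism f of a finite-dimensional space, computed
   in any coordinates e (MathComp matrices act on row vectors); the value 0 in
   infinite dimension is junk. *)
Definition lmod_trace (V : lmodType K) (f : V -> V) : K :=
  xget 0 [set c | exists N (e : {linear V -> 'rV[K]_N}) (M : 'M[K]_N),
    [/\ bijective e, forall v, e (f v) = e v *m M & c = \tr M]].

Definition ch n (V : sn_module K n) : symfun n :=
  (n`!%:R : K)^-1 *:
    \sum_(w : 'S_n) lmod_trace (@sn_act K n V w) *: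
      SubOf (cycle_power_sum_symfun w).

(* Formal power series in q with coefficients in A, and multiplication by a
   polynomial in q. *)
Definition qmul (A : lmodType K) (p : {poly K}) (F : nat -> A) : nat -> A :=
  fun i => \sum_(j < i.+1) p`_j *: F (i - j)%N.

(* sum_(i >= 0) ch (M_(2i)) q^i, with M graded by cohomological degree *)
Definition q_frobenius n (M : graded_sn_module K n) : nat -> symfun n :=
  fun i => ch (M (2 * i)%N).

End PolyFamily.

Import numFieldTopology.Exports.
Local Open Scope classical_set_scope.
Local Open Scope ring_scope.

Section Singular.
Variable R : realType.

Definition simplex (k : nat) : set 'rV[R]_k.+1 :=
  [set x | (forall i, 0 <= x 0 i) /\ \sum_i x 0 i = 1].
Arguments simplex : clear implicits.

Section Face.
Variables (k : nat) (i : 'I_k.+2).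

Definition face_row (x : 'rV[R]_k.+1) : 'rV[R]_k.+2 :=
  \row_j (if unlift i j is Some j' then x 0 j' else 0).

Fact face_simplex (x : set_type (simplex k)) :
  face_row (set_val x) \in simplex k.+1.
Proof.
have [x0 x1] : simplex k (set_val x) by apply: set_valP.
apply/mem_set; split=> [j|].
  by rewrite mxE; case: unliftP.
rewrite (bigD1_ord i) //= mxE unlift_none add0r -[RHS]x1.
by apply: eq_bigr => j _; rewrite mxE liftK.
Qed.

Definition face (x : set_type (simplex k)) : set_type (simplex k.+1) :=
  exist _ (face_row (set_val x)) (face_simplex x).

Fact face_row_continuous : continuous face_row.
Proof.
move=> x A [P Px PA]; exists (fun a j => P a (lift i j)).
  by move=> a j; have := Px a (lift i j); rewrite mxE liftK (ord1 a).
move=> y Py; apply: PA => a j; rewrite mxE.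
case: unliftP => [j' ->|jE]; first by have := Py a j'; rewrite (ord1 a).
have := Px a j; rewrite mxE jE unlift_none => /nbhs_singleton.
by [].
Qed.

Fact face_continuous : continuous face.
Proof.
apply/continuousP => _ [A Aop <-].
rewrite (_ : _ @^-1` _ = set_val @^-1` (face_row @^-1` A)) //.
have [h _] := continuousP face_row.
have {}h := h face_row_continuous _ Aop.
by exists (face_row @^-1` A).
Qed.
HB.instance Definition _ := isContinuous.Build _ _ face face_continuous.
End Face.

Variables (K : fieldType) (X : topologicalType).

Definition singular_simplex (k : nat) := continuousType (set_type (simplex k)) X.

Definition cochain (k : nat) := singular_simplex k -> K^o.
HB.instance Definition _ k := GRing.Lmodule.on (cochain k).

Definition simplex_face k (i : 'I_k.+2) (s : singular_simplex k.+1) :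
  singular_simplex k := s \o face i.

Definition coboundary k (c : cochain k) : cochain k.+1 :=
  fun s => \sum_(i < k.+2) (-1) ^+ i * c (simplex_face i s).

Fact coboundary_linear k : linear (@coboundary k).
Proof.
move=> a c d; apply: funext => s; rewrite /coboundary.
rewrite -[RHS]/(a * _ + _) mulr_sumr -big_split /=.
by apply: eq_bigr => i _; rewrite mulrDr mulrCA.
Qed.

Definition cocycle_pred k : {pred cochain k} := fun c => `[< coboundary c = 0 >].

Definition coboundary_pred k : {pred cochain k} :=
  if k is k'.+1 then fun c => `[< exists b : cochain k', c = coboundary b >]
  else fun c => `[< c = 0 >].

Lemma coboundary0 k : coboundary (0 : cochain k) = 0.
Proof.
have := coboundary_linear (-1) (0 : cochain k) 0.
by rewrite scaler0 addr0 scaleN1r addNr.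
Qed.

Fact cocycle_submod_closed k : submod_closed (@cocycle_pred k).
Proof.
split=> [|a c d]; first by apply/asboolP; apply: coboundary0.
move=> /asboolP hc /asboolP hd; apply/asboolP.
by rewrite coboundary_linear hc hd scaler0 addr0.
Qed.
HB.instance Definition _ k :=
  GRing.isSubmodClosed.Build K (cochain k) (@cocycle_pred k)
    (@cocycle_submod_closed k).

Fact coboundary_submod_closed k : submod_closed (@coboundary_pred k).
Proof.
case: k => [|k]; split=> [|a c d].
- exact/asboolP.
- move=> /asboolP -> /asboolP ->; apply/asboolP.
  by rewrite scaler0 addr0.
- by apply/asboolP; exists 0; rewrite coboundary0.
- move=> /asboolP[b ->] /asboolP[b' ->]; apply/asboolP.
  by exists (a *: b + b'); rewrite coboundary_linear.
Qed.
HB.instance Definition _ k :=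
  GRing.isSubmodClosed.Build K (cochain k) (@coboundary_pred k)
    (@coboundary_submod_closed k).

(* cocycles / coboundaries; the latter are contained in the former *)
Definition singular_cohomology (k : nat) : lmodType K :=
  subquot (@cocycle_pred k) (@coboundary_pred k).

End Singular.

Section Flags.
Variables (K : numClosedFieldType) (n : nat).

(* V i is the (i+1)-dimensional member of the flag *)
Record flag := Flag {
  flag_space :> 'I_n -> {vspace 'cV[K]_n};
  flag_dim : forall i, \dim (flag_space i) = i.+1;
  flag_sub : forall i j : 'I_n, (i <= j)%N ->
    (flag_space i <= flag_space j)%VS }.

HB.instance Definition _ := gen_eqMixin flag.
HB.instance Definition _ := gen_choiceMixin flag.

Definition GL : set 'M[K]_n := [set g | g \in unitmx].

Definition col_span (g : 'M[K]_n) (i : 'I_n) : {vspace 'cV[K]_n} :=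
  <<[seq col j g | j <- [seq j : 'I_n <- enum 'I_n | (j <= i)%N]]>>%VS.

Lemma col_free (g : 'M[K]_n) : g \in unitmx -> free [seq col j g | j : 'I_n <- enum 'I_n].
Proof.
move=> gU; have -> : [seq col j g | j : 'I_n <- enum 'I_n] = [tuple col j g | j < n].
  by [].
apply/freeP=> c c0 j.
have gc0 : g *m \col_j c j = 0.
  rewrite -c0; apply/matrixP=> a b; rewrite !mxE summxE; apply: eq_bigr => l _.
  by rewrite -tnth_nth tnth_mktuple !mxE mulrC.
have := congr1 (mulmx (invmx g)) gc0; rewrite mulKmx // mulmx0.
by move/matrixP/(_ j 0); rewrite !mxE.
Qed.

Lemma col_span_dim (g : 'M[K]_n) (i : 'I_n) : g \in unitmx -> \dim (col_span g i) = i.+1.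
Proof.
move=> /col_free; set p := fun j : 'I_n => (j <= i)%N.
rewrite -(perm_free (perm_map _ (permEl (perm_filterC p _)))) map_cat.
move=> /catl_free /eqP ->; rewrite size_map -(size_map val).
by rewrite -(filter_map _ (leq^~ i)) val_enum_ord (filter_iota_leq 0) ?size_iota.
Qed.

Lemma col_span_sub g (i j : 'I_n) : (i <= j)%N ->
  (col_span g i <= col_span g j)%VS.
Proof.
move=> ij; apply: sub_span => v /mapP[l]; rewrite mem_filter => /andP[li _] ->.
by apply: map_f; rewrite mem_filter mem_enum (leq_trans li).
Qed.

Definition GL_flag (g : set_type GL) : flag :=
  Flag (fun i => col_span_dim i (set_valP g)) (@col_span_sub (set_val g)).

(* The topology of Fl(n) = GL_n / B: the quotient topology for GL_flag. *)
Definition flag_open : set_system flag := [set U | open (GL_flag @^-1` U)].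

Fact flag_openT : flag_open setT.
Proof. exact: openT. Qed.
Fact flag_openI : setI_closed flag_open.
Proof. by move=> U V; apply: openI. Qed.
Fact flag_open_bigU (I : Type) (f : I -> set flag) :
  (forall i, flag_open (f i)) -> flag_open (\bigcup_i f i)%classic.
Proof.
move=> fo; rewrite /flag_open /= preimage_bigcup.
by apply: bigcup_open => i _; apply: fo.
Qed.
HB.instance Definition _ :=
  isOpenTopological.Build flag flag_openT flag_openI flag_open_bigU.

(* X(h) for S = diag_mx s *)
Definition hessenberg_variety (s : 'rV[K]_n) (h : 'I_n -> 'I_n) : set flag :=
  [set V : flag | forall (i : 'I_n) (v : 'cV[K]_n), v \in V i -> diag_mx s *m v \in V (h i)].

End Flags.

(* H^m(X(h)): singular cohomology with complex coefficients of the space of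
   flags, S being diagonal with real entries s *)
Definition HX (R : realType) n (s : 'I_n -> R) (h : 'I_n -> 'I_n) (m : nat) :
    lmodType R[i] :=
  singular_cohomology R R[i]
    (set_type (hessenberg_variety (\row_i ((s i)%:C)%C) h)) m.

(* Main.v *)
From HB Require Import structures.
Require Import Defs.
From mathcomp Require Import all_boot all_order all_algebra all_fingroup.
From mathcomp Require Import mpoly.
From mathcomp Require Import ring zify.
From mathcomp.real_closed Require Import complex.
From mathcomp Require Import boolp classical_sets functions reals.

Set Implicit Arguments.
Unset Strict Implicit.
Unset Printing Implicit Defensive.

Import GRing.Theory.
Local Open Scope ring_scope.

(** The condition defining the graph cohomology ring H_T is symmetric in the two
    ends of an edge, so a Hessenberg function enters through its graph on the
    vertices 1, .., n.  On graphs, both kinds of modular triples have the same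
    shape ([modular_graphs_C], [modular_graphs_R]).  There are vertices a, b, c
    such that a and b are adjacent, the transposition r = (a b) is an
    automorphism of the graph of h_-, and the graphs of h and h_+ arise from
    that of h_- by adding first the edge {c, a} and then the edge {c, b}.
    Hence r is an automorphism of the graph of h_+ as well.

    Let r act on functions on S_n by (f r)(w) = f (w r), and consider the
    functions alpha(w) = t_{w(b)} - t_{w(a)} and beta(w) = t_{w(c)} - t_{w(a)}.
    They satisfy alpha r = - alpha and beta - beta r = alpha, and they are fixed
    by the dot action.  As {a, b} is an edge, the divided difference
    D f = (f - f r) / alpha has polynomial values for f in H_T; it is r-invariant
    and, when r is an automorphism of the graph, it lies in H_T again, since
    alpha is a nonzerodivisor modulo the label of every other edge.

    Let A_- and A_+ be the r-invariant parts of H_T(h_-) and H_T(h_+).  Then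

      H_T(h_-) = A_- (+) alpha A_-,     H_T(h_+) = A_+ (+) alpha A_+,
      H_T(h)   = A_+ (+) beta A_-,

    where the first two decompositions split f into (f + f r) / 2 and
    alpha D f / 2, and the last one splits it into f - beta D f and beta D f: the
    first summand is r-invariant, so that its congruence along {c, a} gives
    the one along {c, b}, and multiplication by beta restores the congruence
    along {c, a}.  Consequently both sides of the asserted isomorphism are
    A_+ (+) A_-[-2] (+) A_+[-2] (+) A_-[-4].  The resulting isomorphism
    (f, f') |-> (P f + alpha P f', D f + alpha D f') with P f = f - beta D f, and
    its inverse, are linear over C[t_1, .., t_n] and commute with the dot action;
    so they descend to the quotients by (t_1, .., t_n) ([modular_graded_iso]).

    For the modular law, the Frobenius characteristic has to be additive; this
    holds because the graded pieces are finite-dimensional ([findim_HG]), so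
    that traces may be computed in coordinates. *)

(** * Divisibility by differences of two variables *)

Section Collapse.
Variables (K : fieldType) (n : nat).
Local Notation HBT := {mpoly K[n]}.
Implicit Types (i j l : 'I_n) (p q : HBT).

(** The substitution t_i := t_j.  Its kernel is the ideal of the difference
    t_i - t_j, and its values lie in a domain; so congruences modulo an edge
    label become equations in which nonzero factors can be cancelled. *)
Definition collapse i j p : HBT :=
  p \mPo [tuple 'X_(if l == i then j else l) | l < n].

Lemma collapseXU i j l : collapse i j 'X_l = 'X_(if l == i then j else l).
Proof. by rewrite /collapse comp_mpolyXU -tnth_nth tnth_mktuple. Qed.

Lemma collapseB i j : {morph collapse i j : p q / p - q}.
Proof. exact: comp_mpolyB. Qed.

Lemma collapseM i j : {morph collapse i j : p q / p * q}.
Proof. by move=> p q; apply: rmorphM. Qed.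

Lemma collapseXB i j : collapse i j ('X_i - 'X_j) = 0.
Proof. by rewrite collapseB !collapseXU eqxx; case: ifP => _; rewrite subrr. Qed.

Lemma mpolyXU_inj : injective (fun i : 'I_n => 'X_i : HBT).
Proof.
move=> i j /(congr1 (fun p : HBT => p@_(U_(j)%MM))).
rewrite !mcoeffX eqxx; case: eqP => [/mnmP/(_ j)|_ /eqP]; last by rewrite eq_sym oner_eq0.
by rewrite !mnm1E eqxx; case: eqP.
Qed.

Lemma mpolyXB_eq0 i j : (('X_i - 'X_j : HBT) == 0) = (i == j).
Proof. by rewrite subr_eq0 (inj_eq mpolyXU_inj). Qed.

(** Homogeneity of degree m - 2, which forces 0 when m < 2, in the same
    pattern-matching form as the shift of graded modules. *)
Definition lowered2 (m : nat) p :=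
  if m is m'.+2 then p \is m'.-homog for (@cohdeg n) else p == 0.

Lemma lowered2_lin m a p q : lowered2 m p -> lowered2 m q -> lowered2 m (a *: p + q).
Proof.
case: m => [|[|m]] /=; try by move=> /eqP-> /eqP->; rewrite scaler0 addr0.
by move=> hp hq; rewrite rpredD ?rpredZ.
Qed.

Lemma homog_mpolyXU i : ('X_i : HBT) \is 2.-homog for (@cohdeg n).
Proof. by rewrite dhomogX /= /cohdeg mdeg1. Qed.

(** Replacing the variables of a monomial one at a time exhibits the quotient
    together with its degree. *)
Lemma collapse_mpolyX i j (m : 'X_{1..n}) : exists q,
  'X_[m] - collapse i j 'X_[m] = ('X_i - 'X_j) * q /\ lowered2 (cohdeg m) q.
Proof.
move: {2}(mdeg m) (erefl (mdeg m)) => d; elim: d m => [|d IHd] m md.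
  move/eqP: (md); rewrite mdeg_eq0 => /eqP->; exists 0; split.
    by rewrite mpolyX0 /collapse comp_mpoly1 subrr mulr0.
  by rewrite /cohdeg mdeg0 /=.
have [l ml] : exists l, m l != 0%N.
  apply/existsP; apply: contra_eqT md => /existsPn m0.
  by rewrite mdegE big1 // => l _; apply/eqP/negPn/m0.
have mE : m = (U_(l) + (m - U_(l)))%MM by rewrite addmC submK // lep1mP.
move: (m - _)%MM mE => m' mE.
have m'd : mdeg m' = d by move: md; rewrite mE mdegD mdeg1 add1n => -[].
have [q [qE hq]] := IHd m' m'd.
exists ('X_[m'] *+ (l == i) + collapse i j 'X_l * q); split.
  rewrite mE mpolyXD collapseM mulrDr (mulrCA ('X_i - _)) -qE collapseXU.
  have [->|_] := eqVneq l i; rewrite ?mulr1n ?mulr0n; ring.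
have -> : cohdeg m = (cohdeg m').+2 by rewrite mE cohdegD /cohdeg mdeg1.
rewrite /= rpredD ?rpredMn ?dhomogX //=.
case: (cohdeg m') hq => [|[|e]] /= hq; try by rewrite (eqP hq) mulr0 dhomog0.
by rewrite collapseXU; apply: dhomogM (homog_mpolyXU _) hq.
Qed.

Lemma collapse_divide i j p : collapse i j p = 0 -> exists q,
  p = ('X_i - 'X_j) * q /\
  forall m, p \is m.-homog for (@cohdeg n) -> lowered2 m q.
Proof.
move=> p0.
suff [q [qE hq]] : exists q, p - collapse i j p = ('X_i - 'X_j) * q /\
    forall m, {in msupp p, forall mm, cohdeg mm = m} -> lowered2 m q.
  by exists q; split=> [|m /dhomog_mf]; [rewrite -qE p0 subr0|apply: hq].
rewrite [X in X - _]mpolyE [X in collapse i j X]mpolyE.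
elim: (msupp p) => [|mm s [q [qE hq]]].
  exists 0; rewrite big_nil /collapse comp_mpoly0 subr0 mulr0; split=> //.
  by case=> [|[|m]] _ //=; rewrite dhomog0.
have [q' [qE' hq']] := collapse_mpolyX i j mm.
exists (p@_mm *: q' + q); split; last first.
  move=> m hs; apply: lowered2_lin; first by rewrite -(hs mm (mem_head _ _)).
  by apply: hq => x xs; apply: hs; rewrite inE xs orbT.
rewrite !big_cons {1}/collapse comp_mpolyD comp_mpolyZ -/(collapse i j _).
by rewrite mulrDr -scalerAr -qE' -qE scalerBr addrACA opprD.
Qed.

End Collapse.

(** * Graph cohomology as congruences along the edges of a graph *)

Section Congruences.
Variables (K : fieldType) (n : nat).
Local Notation HBT := {mpoly K[n]}.
Local Notation F := {ffun 'S_n -> HBT}.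
Implicit Types (k : 'I_n -> 'I_n) (i j l x y : 'I_n) (w s : 'S_n) (p q : HBT) (f g : F).

Definition adj k i j : bool := (j < i <= k j)%N || (i < j <= k i)%N.

Lemma adj_neq k i j : adj k i j -> i != j.
Proof. by case/orP=> /andP[+ _]; apply: contraTneq => ->; rewrite ltnn. Qed.

Lemma adjC k i j : adj k i j = adj k j i.
Proof. exact: orbC. Qed.

Lemma adj_irr k i : adj k i i = false.
Proof. by rewrite /adj ltnn. Qed.

(** Divisibility of f(w) - f(w (i, j)) by t_{w(i)} - t_{w(j)}, as an equation. *)
Definition congr_at f w i j : Prop :=
  collapse (w i) (w j) (f w) = collapse (w i) (w j) (f (tperm i j * w)%g).

(** Swapping i and j only changes the sign of the label, so the congruences may
    be read along unoriented edges. *)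
Lemma in_HTP k f :
  in_HT k f <-> forall w i j, adj k i j -> congr_at f w i j.
Proof.
split=> [Hf w i j /orP[] /andP[lt le]|Hf w i j lt le].
- have [g gE] := Hf w i j lt le; apply/eqP; rewrite -subr_eq0 -collapseB gE.
  by rewrite collapseM collapseXB mul0r.
- have [g gE] := Hf w j i lt le; apply/eqP; rewrite -subr_eq0 tpermC -collapseB gE.
  by rewrite -opprB mulNr -mulrN collapseM collapseXB mul0r.
have /eqP := Hf w i j (introT orP (or_introl (introT andP (conj lt le)))).
rewrite -subr_eq0 -collapseB => /eqP /collapse_divide [q [qE _]].
by exists q.
Qed.

Definition fmul f g : F := [ffun w => f w * g w].

Lemma in_HT_mul k f g : in_HT k f -> in_HT k g -> in_HT k (fmul f g).
Proof.
move=> /in_HTP Hf /in_HTP Hg; apply/in_HTP => w i j ij.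
by rewrite /congr_at !ffunE !collapseM Hf // Hg.
Qed.

Lemma in_HTB k f g : in_HT k f -> in_HT k g -> in_HT k (f - g).
Proof.
move=> Hf Hg; rewrite addrC -scaleN1r; exact: in_HT_lin Hg Hf.
Qed.

Lemma in_HTD k f g : in_HT k f -> in_HT k g -> in_HT k (f + g).
Proof. by move=> Hf Hg; rewrite -[f]scale1r; apply: in_HT_lin. Qed.

Lemma in_HTZ k (x : K) f : in_HT k f -> in_HT k (x *: f).
Proof. by move=> Hf; rewrite -[_ *: _]addr0; exact: (in_HT_lin x Hf (@in_HT0 K n k)). Qed.

(** A global choice of edge labels: as a function of w, it is itself a class
    in H_T and a fixed point of the dot action. *)
Definition label i j : F := [ffun w : 'S_n => 'X_(w j) - 'X_(w i)].

Lemma in_HT_label k i j : in_HT k (label i j).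
Proof.
have HX l : in_HT k [ffun w : 'S_n => 'X_(w l) : HBT].
  apply/in_HTP => w x y _; rewrite /congr_at !ffunE !collapseXU permM.
  by case: tpermP => [->|->|/eqP xl /eqP yl] //; rewrite !eqxx; case: eqP.
have -> : label i j = [ffun w : 'S_n => 'X_(w j) : HBT] - [ffun w : 'S_n => 'X_(w i) : HBT].
  by apply/ffunP=> w; rewrite !ffunE.
exact: in_HTB.
Qed.

Lemma dot_label s i j : dot s (label i j) = label i j.
Proof.
by apply/ffunP=> w; rewrite !ffunE msymB !msymXU !permM !permKV.
Qed.

Lemma dot_mul s f g : dot s (fmul f g) = fmul (dot s f) (dot s g).
Proof. by apply/ffunP=> w; rewrite !ffunE msymM. Qed.

Lemma label_neq0 i j w : i != j -> label i j w != 0.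
Proof. by rewrite ffunE mpolyXB_eq0 (inj_eq perm_inj) eq_sym. Qed.

(** The labels t_{w(j)} - t_{w(i)} and t_{w(x)} - t_{w(y)} are coprime unless
    {i, j} = {x, y}. *)
Lemma collapse_label_neq0 x y i j w : i != j -> tperm x y != tperm i j ->
  collapse (w x) (w y) (label i j w) != 0.
Proof.
move=> ij xy; rewrite ffunE collapseB !collapseXU !(inj_eq perm_inj).
rewrite -!(fun_if w) mpolyXB_eq0 (inj_eq perm_inj).
have [jx|jx] := eqVneq j x; have [ix|ix] := eqVneq i x.
- by rewrite ix jx eqxx in ij.
- by rewrite eq_sym; apply: contra_neq xy => ->; rewrite jx tpermC.
- by apply: contra_neq xy => ->; rewrite ix.
- by rewrite eq_sym.
Qed.

Definition homog_fun m f : Prop := forall w, f w \is m.-homog for (@cohdeg n).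

Lemma hom_label m f i j : homog_fun m f -> homog_fun m.+2 (fmul (label i j) f).
Proof.
move=> hf w; rewrite !ffunE -[m.+2]/(2 + m)%N; apply: dhomogM; last exact: hf.
by rewrite rpredB ?homog_mpolyXU.
Qed.

Definition hscale p f : F := [ffun w => p * f w].

Lemma in_HT_hscale k p f : in_HT k f -> in_HT k (hscale p f).
Proof.
by move=> Hf w i j ji ijk; have [g gE] := Hf w i j ji ijk;
  exists (p * g); rewrite !ffunE -mulrBr gE mulrCA.
Qed.

End Congruences.

(** * The right reflection and its divided difference *)

Section DividedDifference.
Variables (K : fieldType) (n : nat) (a b : 'I_n).
Hypothesis neq_ab : a != b.
Local Notation HBT := {mpoly K[n]}.
Local Notation F := {ffun 'S_n -> HBT}.
Implicit Types (k : 'I_n -> 'I_n) (i j l : 'I_n) (w s : 'S_n) (p q : HBT) (f g : F).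
Local Notation r := (tperm a b).
Local Notation alpha := (label K a b).

Definition refl_right f : F := [ffun w : 'S_n => f (r * w)%g].

(** r is an automorphism of the graph of k; for adjacent a and b this means that
    they have the same neighbours apart from each other. *)
Definition twins k : Prop := forall i j, adj k (r i) (r j) = adj k i j.

(** Exchanging a and b preserves the edge {a, b}, so only the other vertices
    have to be checked. *)
Lemma twinsP k :
  (forall j, j != a -> j != b -> adj k j a = adj k j b) -> twins k.
Proof.
move=> side i j.
have sideC l : l != a -> l != b -> adj k a l = adj k b l.
  by move=> la lb; rewrite adjC side // adjC.
case: tpermP => [->|->|/eqP ia /eqP ib]; case: tpermP => [->|->|/eqP ja /eqP jb].
- by rewrite !adj_irr.
- exact: adjC.
- by rewrite sideC.
- exact: adjC.
- by rewrite !adj_irr.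
- exact: sideC.
- by rewrite side.
- exact: side.
- by [].
Qed.

Lemma in_HT_refl_right k f : twins k -> in_HT k f -> in_HT k (refl_right f).
Proof.
move=> tk /in_HTP Hf; apply/in_HTP=> w i j ij.
have := Hf (r * w)%g (r i) (r j); rewrite tk => /(_ ij).
rewrite /congr_at !permM !tpermK !ffunE => ->.
by congr (collapse _ _ (f _)); rewrite -tpermJ conjgE tpermV -!mulgA (mulgA r r w) tperm2 mul1g.
Qed.

Lemma alpha_r w : alpha (r * w)%g = - alpha w.
Proof. by rewrite !ffunE !permM tpermL tpermR opprB. Qed.

(** The choice is unambiguous where alpha divides f - f r, in particular on
    H_T; elsewhere it is arbitrary. *)
Definition divdiff f : F :=
  [ffun w => xget 0 [set q | f w - f (r * w)%g = alpha w * q]]%classic.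

Lemma divdiffE k f w : adj k a b -> in_HT k f ->
  alpha w * divdiff f w = f w - f (r * w)%g.
Proof.
move=> kab /in_HTP/(_ w a b kab) Hf; rewrite !ffunE.
case: xgetP => [q _ -> //|/= H].
have /collapse_divide [q [qE _]] :
  collapse (w a) (w b) (f w - f (r * w)%g) = 0 by rewrite collapseB Hf subrr.
by case: (H (- q)); rewrite /= qE mulrN -mulNr opprB.
Qed.

Lemma divdiff_uniq k f g : adj k a b -> in_HT k f ->
  (forall w, alpha w * g w = f w - f (r * w)%g) -> divdiff f = g.
Proof.
move=> kab Hf gE; apply/ffunP=> w; apply: (mulfI (label_neq0 _ w neq_ab)).
by rewrite (divdiffE w kab Hf) gE.
Qed.

Lemma divdiff_r k f w : adj k a b -> in_HT k f ->
  divdiff f (r * w)%g = divdiff f w.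
Proof.
move=> kab Hf; apply: (mulfI (label_neq0 _ w neq_ab)).
rewrite (divdiffE w kab Hf) -[alpha w]opprK -alpha_r mulNr.
by rewrite (divdiffE _ kab Hf) mulgA tperm2 mul1g opprB.
Qed.

(** On the edge {a, b}, the invariance of the divided difference gives the
    congruence; on any other edge, alpha is nonzero after collapsing and can be
    cancelled. *)
Lemma in_HT_divdiff k f : twins k -> adj k a b -> in_HT k f -> in_HT k (divdiff f).
Proof.
move=> tk kab Hf; apply/in_HTP=> w i j ij.
have [tE|tN] := eqVneq (tperm i j) r.
  by rewrite /congr_at tE (divdiff_r _ kab Hf).
have /in_HTP/(_ w i j ij) cf := Hf.
have /in_HTP/(_ w i j ij) cr := in_HT_refl_right tk Hf.
have /in_HTP/(_ w i j ij) ca := @in_HT_label K n k a b.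
apply: (mulfI (collapse_label_neq0 _ w neq_ab tN)).
rewrite {2}ca -!collapseM !(divdiffE _ kab Hf) !collapseB cf; congr (_ - _).
by move: cr; rewrite /congr_at !ffunE mulgA.
Qed.

Lemma divdiff_hlin k p f g : adj k a b -> in_HT k f -> in_HT k g ->
  divdiff (hscale p f + g) = hscale p (divdiff f) + divdiff g.
Proof.
move=> kab Hf Hg; apply: (@divdiff_uniq k _ _ kab).
  by apply: in_HTD => //; apply: in_HT_hscale.
move=> w; have := divdiffE w kab Hf; have := divdiffE w kab Hg.
move: (divdiff f) (divdiff g) => f' g' gE fE.
have -> : (hscale p f' + g') w = p * f' w + g' w by rewrite !ffunE.
by rewrite mulrDr mulrCA fE gE !ffunE; ring.
Qed.

Lemma divdiff_dot k s f : adj k a b -> in_HT k f ->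
  divdiff (dot s f) = dot s (divdiff f).
Proof.
move=> kab Hf; apply: (@divdiff_uniq k _ _ kab); first exact: dot_HT.
move=> w; rewrite -[alpha in LHS](dot_label K s).
have -> : dot s alpha w * dot s (divdiff f) w = dot s (fmul alpha (divdiff f)) w.
  by rewrite dot_mul [RHS]ffunE.
have -> : fmul alpha (divdiff f) = f - refl_right f.
  by apply/ffunP=> v; rewrite [LHS]ffunE (divdiffE v kab Hf) !ffunE.
by rewrite linearB !ffunE mulgA.
Qed.

Lemma divdiff_lowered k m f : adj k a b -> in_HT k f -> homog_fun m f ->
  forall w, lowered2 m (divdiff f w).
Proof.
move=> kab Hf hf w; have /in_HTP/(_ w a b kab) c := Hf.
have /collapse_divide [q [qE hq]] :
  collapse (w a) (w b) (f w - f (r * w)%g) = 0 by rewrite collapseB c subrr.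
have -> : divdiff f w = (-1) *: q + 0.
  apply: (mulfI (label_neq0 _ w neq_ab)).
  by rewrite (divdiffE w kab Hf) qE ffunE scaleN1r; ring.
apply: lowered2_lin; first by apply: hq; apply: rpredB; apply: hf.
by case: (m) => [|[|?]] //=; rewrite dhomog0.
Qed.

End DividedDifference.

(** * Quotients by (t_1, .., t_n) and the maps induced on them *)

Section LinearIsomorphisms.
Variable K : fieldType.

Lemma linear_pack (V W : lmodType K) (u : V -> W) : linear u ->
  exists e : {linear V -> W}, e =1 u.
Proof.
move=> uL; pose uP := GRing.isLinear.Build K V W *:%R u uL.
by exists (HB.pack u uP : {linear V -> W}).
Qed.

Lemma lin_iso_of (V W : lmodType K) (u : V -> W) (v : W -> V) :
  linear u -> cancel u v -> cancel v u -> exists e : lin_iso V W, e =1 u.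
Proof.
move=> uL uK vK; have [e eE] := linear_pack uL.
have eK : cancel e v by move=> x; rewrite eE uK.
have vK' : cancel v e by move=> x; rewrite eE vK.
by exists (LinIso eK vK').
Qed.

End LinearIsomorphisms.

Section InducedMaps.
Variables (K : fieldType) (n : nat).
Local Notation HBT := {mpoly K[n]}.
Local Notation F := {ffun 'S_n -> HBT}.
Implicit Types (k : 'I_n -> 'I_n) (m : nat) (f g : F).

Lemma HT_predP k m f : reflect (in_HT k f /\ homog_fun m f) (f \in HT_pred k m).
Proof. exact: asboolP. Qed.

(** Classes of arbitrary functions, sent to 0 outside the homogeneous part of
    H_T: membership proofs then stay out of the terms. *)
Definition coh_class k m f : HG K k m :=
  subquot_pi (ideal_pred k) (insubd (0 : sub_of (HT_pred k m)) f).

Lemma coh_class_eq k m f g : f \in HT_pred k m -> g \in HT_pred k m ->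
  coh_class k m f = coh_class k m g <-> in_ideal k (f - g).
Proof.
move=> fZ gZ; rewrite /coh_class subquot_piP.
rewrite -![sub_val _]/(val _) !insubdK //; split=> [/asboolP//|?]; exact/asboolP.
Qed.

Lemma coh_class_surj k m (x : HG K k m) : exists2 f, f \in HT_pred k m & x = coh_class k m f.
Proof.
exists (sub_val (generic_quotient.repr x)); first exact: (valP (generic_quotient.repr x)).
rewrite /coh_class -[sub_val _]/(val _) valKd.
by rewrite subquot_piK.
Qed.

Lemma coh_class_lin k m c f g : f \in HT_pred k m -> g \in HT_pred k m ->
  coh_class k m (c *: f + g) = c *: coh_class k m f + coh_class k m g.
Proof.
move=> fZ gZ; rewrite /coh_class -subquot_piZ -subquot_piD; congr subquot_pi.
apply: val_inj; rewrite insubdK ?rpredD ?rpredZ //.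
by rewrite [RHS]sub_val_linear -![sub_val _]/(val _) !insubdK.
Qed.

Lemma coh_classD k m f g : f \in HT_pred k m -> g \in HT_pred k m ->
  coh_class k m (f + g) = coh_class k m f + coh_class k m g.
Proof. by move=> fZ gZ; rewrite -[f]scale1r coh_class_lin // !scale1r. Qed.

Lemma coh_class0 k m : coh_class k m 0 = 0.
Proof. by apply: (addrI (coh_class k m 0)); rewrite -coh_classD ?rpred0 // !addr0. Qed.

Lemma coh_class_act k m (s : 'S_n) f : f \in HT_pred k m ->
  sn_act s (coh_class k m f) = coh_class k m (dot s f).
Proof.
move=> fZ; rewrite /= /HG_act /coh_class (subquot_map_pi _ (@dot_ideal _ _ _ s)).
congr subquot_pi; apply: val_inj.
by rewrite insubdK ?dot_HT_pred //= -[sub_val _]/(val _) insubdK.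
Qed.

Lemma in_idealE k0 f : in_ideal k0 f <-> exists2 g : 'I_n -> F,
  (forall i, in_HT k0 (g i)) & f = \sum_(i < n) hscale 'X_i (g i).
Proof.
have sumE (g : 'I_n -> F) w :
    (\sum_(i < n) hscale 'X_i (g i)) w = \sum_(i < n) 'X_i * g i w.
  by rewrite sum_ffunE; apply: eq_bigr => i _; rewrite ffunE.
split=> [[g Hg fE]|[g Hg ->]]; exists g => //.
by apply/ffunP=> w; rewrite fE sumE.
Qed.

(** Maps between graph cohomology rings that are linear over the polynomial
    ring and commute with the dot action; only the restriction to H_T
    counts, as divided differences are meaningless elsewhere. *)
Record HT_mor k k' (T : F -> F) : Prop := {
  HT_mor_in : forall f, in_HT k f -> in_HT k' (T f);
  HT_mor_lin : forall p f g, in_HT k f -> in_HT k g ->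
    T (hscale p f + g) = hscale p (T f) + T g;
  HT_mor_dot : forall s f, in_HT k f -> T (dot s f) = dot s (T f) }.

Definition has_deg k m m' (T : F -> F) : Prop :=
  forall f, in_HT k f -> homog_fun m f -> homog_fun m' (T f).

Lemma hscaleN1 f : hscale (- 1) f = - f.
Proof. by apply/ffunP=> w; rewrite !ffunE mulN1r. Qed.

Lemma hscaleC c f : hscale c%:MP f = c *: f.
Proof. by apply/ffunP=> w; rewrite !ffunE mul_mpolyC. Qed.

Section Mor.
Variables (k k' : 'I_n -> 'I_n) (T : F -> F).
Hypothesis TM : HT_mor k k' T.

Lemma HT_mor0 : T 0 = 0.
Proof.
have := HT_mor_lin TM (-1) (@in_HT0 K n k) (@in_HT0 K n k).
by rewrite !hscaleN1 oppr0 addr0 addNr.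
Qed.

Lemma HT_morB f g : in_HT k f -> in_HT k g -> T (f - g) = T f - T g.
Proof. by move=> Hf Hg; rewrite addrC -hscaleN1 (HT_mor_lin TM) // hscaleN1 addrC. Qed.

Lemma HT_mor_sum (g : 'I_n -> F) (s : seq 'I_n) : (forall i, in_HT k (g i)) ->
  T (\sum_(i <- s) hscale 'X_i (g i)) = \sum_(i <- s) hscale 'X_i (T (g i)).
Proof.
move=> Hg; suff [] : in_HT k (\sum_(i <- s) hscale 'X_i (g i)) /\
  T (\sum_(i <- s) hscale 'X_i (g i)) = \sum_(i <- s) hscale 'X_i (T (g i)) by [].
elim: s => [|i s [IH IHT]]; first by rewrite !big_nil HT_mor0; split=> //; apply: in_HT0.
rewrite !big_cons (HT_mor_lin TM) // IHT; split=> //.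
by apply: in_HTD => //; apply: in_HT_hscale.
Qed.

(** Linearity over the polynomial ring carries combinations of the t_i to
    combinations of the t_i. *)
Lemma HT_mor_ideal f g : in_HT k f -> in_HT k g -> in_ideal k (f - g) ->
  in_ideal k' (T f - T g).
Proof.
move=> Hf Hg /in_idealE[u Hu fE]; apply/in_idealE.
exists (fun i => T (u i)) => [i|]; first exact: (HT_mor_in TM (Hu i)).
by rewrite -HT_morB // fE HT_mor_sum.
Qed.

Section Deg.
Variables m m' : nat.
Hypothesis Tm : has_deg k m m' T.

Lemma HT_mor_pred f : f \in HT_pred k m -> T f \in HT_pred k' m'.
Proof.
by move=> /HT_predP[Hf hf]; apply/HT_predP; split; [apply: (HT_mor_in TM)|apply: Tm].
Qed.

End Deg.
End Mor.

Definition HG_map k k' m m' (T : F -> F) (x : HG K k m) : HG K k' m' :=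
  coh_class k' m' (T (sub_val (generic_quotient.repr x))).

Section MapTheory.
Variables (k k' : 'I_n -> 'I_n) (m m' : nat) (T : F -> F).
Hypotheses (TM : HT_mor k k' T) (Tm : has_deg k m m' T).
Local Notation TH := (@HG_map k k' m m' T).

Lemma HG_map_class f : f \in HT_pred k m -> TH (coh_class k m f) = coh_class k' m' (T f).
Proof.
move=> fZ; set x := coh_class k m f; rewrite /HG_map.
have yZ : sub_val (generic_quotient.repr x) \in HT_pred k m := valP (generic_quotient.repr x).
apply: (coh_class_eq (HT_mor_pred TM Tm yZ) (HT_mor_pred TM Tm fZ)).2.
have xE : coh_class k m (sub_val (generic_quotient.repr x)) = x.
  by rewrite /coh_class -[sub_val _]/(val _) valKd subquot_piK.
move/(coh_class_eq yZ fZ).1: xE; case/HT_predP: yZ => Hy _; case/HT_predP: fZ => Hf _.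
exact: HT_mor_ideal TM _ _ Hy Hf.
Qed.

Lemma HG_map_linear : linear TH.
Proof.
move=> c x y; have [f fZ ->] := coh_class_surj x; have [g gZ ->] := coh_class_surj y.
have /HT_predP[Hf _] := fZ; have /HT_predP[Hg _] := gZ.
rewrite -coh_class_lin // !HG_map_class ?rpredD ?rpredZ //.
by rewrite -coh_class_lin ?(HT_mor_pred TM Tm) // -hscaleC (HT_mor_lin TM) // hscaleC.
Qed.

Lemma HG_mapD : {morph TH : x y / x + y}.
Proof. by move=> x y; have := HG_map_linear 1 x y; rewrite !scale1r. Qed.

Lemma HG_map_act (s : 'S_n) x : TH (sn_act s x) = sn_act s (TH x).
Proof.
have [f fZ ->] := coh_class_surj x; have /HT_predP[Hf _] := fZ.
by rewrite coh_class_act // !HG_map_class ?dot_HT_pred // (HT_mor_dot TM) // coh_class_act ?(HT_mor_pred TM Tm).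
Qed.

End MapTheory.

(** Mutually inverse 2 x 2 matrices of such maps, upstairs on H_T, induce an
    isomorphism of direct sums downstairs.  The index true stands for the first
    summand, and [T i j] maps the summand j to the summand i. *)
Lemma HG_sum_iso (k k' : bool -> 'I_n -> 'I_n) (m m' : bool -> nat)
    (T S : bool -> bool -> F -> F) :
  (forall i j, HT_mor (k j) (k' i) (T i j)) ->
  (forall i j, HT_mor (k' j) (k i) (S i j)) ->
  (forall i j, has_deg (k j) (m j) (m' i) (T i j)) ->
  (forall i j, has_deg (k' j) (m' j) (m i) (S i j)) ->
  (forall i j f, in_HT (k j) f ->
     S i true (T true j f) + S i false (T false j f) = if i == j then f else 0) ->
  (forall i j f, in_HT (k' j) f ->
     T i true (S true j f) + T i false (S false j f) = if i == j then f else 0) ->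
  exists e : lin_iso (sn_sum (HG K (k true) (m true)) (HG K (k false) (m false)))
                     (sn_sum (HG K (k' true) (m' true)) (HG K (k' false) (m' false))),
    forall s x, e (sn_act s x) = sn_act s (e x).
Proof.
move=> TM SM Tm Sm ST TS.
pose row (k1 k2 : bool -> 'I_n -> 'I_n) (m1 m2 : bool -> nat)
    (T1 : bool -> bool -> F -> F) (x : HG K (k1 true) (m1 true) * HG K (k1 false) (m1 false)) i :
    HG K (k2 i) (m2 i) :=
  HG_map (k2 i) (m2 i) (T1 i true) x.1 + HG_map (k2 i) (m2 i) (T1 i false) x.2.
pose u (k1 k2 : bool -> 'I_n -> 'I_n) (m1 m2 : bool -> nat) T1 x :=
  (@row k1 k2 m1 m2 T1 x true, @row k1 k2 m1 m2 T1 x false).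
have uK (k1 k2 : bool -> 'I_n -> 'I_n) (m1 m2 : bool -> nat)
    (T1 T2 : bool -> bool -> F -> F) :
    (forall i j, HT_mor (k1 j) (k2 i) (T1 i j)) ->
    (forall i j, HT_mor (k2 j) (k1 i) (T2 i j)) ->
    (forall i j, has_deg (k1 j) (m1 j) (m2 i) (T1 i j)) ->
    (forall i j, has_deg (k2 j) (m2 j) (m1 i) (T2 i j)) ->
    (forall i j f, in_HT (k1 j) f ->
       T2 i true (T1 true j f) + T2 i false (T1 false j f) = if i == j then f else 0) ->
    cancel (u k1 k2 m1 m2 T1) (u k2 k1 m2 m1 T2).
  move=> M1 M2 D1 D2 id12.
  have comp i j f : f \in HT_pred (k1 j) (m1 j) ->
      HG_map (k1 i) (m1 i) (T2 i true)
        (HG_map (k2 true) (m2 true) (T1 true j) (coh_class (k1 j) (m1 j) f))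
      + HG_map (k1 i) (m1 i) (T2 i false)
        (HG_map (k2 false) (m2 false) (T1 false j) (coh_class (k1 j) (m1 j) f))
      = coh_class (k1 i) (m1 i) (if i == j then f else 0).
    move=> fZ; have /HT_predP[Hf _] := fZ.
    have T1Z i' := HT_mor_pred (M1 i' j) (D1 i' j) fZ.
    rewrite !(HG_map_class (M1 _ _) (D1 _ _)) // !(HG_map_class (M2 _ _) (D2 _ _)) //.
    by rewrite -coh_classD ?id12 //; apply: (HT_mor_pred (M2 _ _) (D2 _ _)).
  case=> x y; rewrite /u /row /=.
  rewrite (HG_mapD (M2 true true) (D2 true true)).
  rewrite (HG_mapD (M2 true false) (D2 true false)).
  rewrite (HG_mapD (M2 false true) (D2 false true)).
  rewrite (HG_mapD (M2 false false) (D2 false false)).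
  have [f fZ ->] := coh_class_surj x; have [g gZ ->] := coh_class_surj y.
  by congr (_, _); rewrite addrACA !comp // coh_class0 ?addr0 ?add0r.
have uL : linear (u k k' m m' T : sn_sum _ _ -> sn_sum _ _).
  move=> c [x1 x2] [y1 y2].
  have rowL i :
      HG_map (k' i) (m' i) (T i true) (c *: x1 + y1) +
      HG_map (k' i) (m' i) (T i false) (c *: x2 + y2) =
      c *: (HG_map (k' i) (m' i) (T i true) x1 + HG_map (k' i) (m' i) (T i false) x2)
      + (HG_map (k' i) (m' i) (T i true) y1 + HG_map (k' i) (m' i) (T i false) y2).
    rewrite (HG_map_linear (TM i true) (Tm i true)).
    by rewrite (HG_map_linear (TM i false) (Tm i false)) scalerDr addrACA.
  exact: (congr2 pair (rowL true) (rowL false)).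
have [e eE] := lin_iso_of uL (uK _ _ _ _ _ _ TM SM Tm Sm ST) (uK _ _ _ _ _ _ SM TM Sm Tm TS).
exists e => s x; rewrite !eE; case: x => x1 x2.
have actD i (v w : HG K (k' i) (m' i)) : sn_act s (v + w) = sn_act s v + sn_act s w.
  by have := sn_act_linear s 1 v w; rewrite !scale1r.
have rowA i :
    HG_map (k' i) (m' i) (T i true) (sn_act s x1) +
    HG_map (k' i) (m' i) (T i false) (sn_act s x2) =
    sn_act s (HG_map (k' i) (m' i) (T i true) x1 + HG_map (k' i) (m' i) (T i false) x2).
  rewrite (HG_map_act (TM i true) (Tm i true)).
  by rewrite (HG_map_act (TM i false) (Tm i false)) actD.
exact: (congr2 pair (rowA true) (rowA false)).
Qed.

End InducedMaps.

(** * Morphisms between graph cohomology rings *)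

Section MorphismConstructions.
Variables (K : fieldType) (n : nat).
Local Notation F := {ffun 'S_n -> {mpoly K[n]}}.
Implicit Types (k : 'I_n -> 'I_n) (f g : F).

Lemma HT_mor_cod k k' k'' (T : F -> F) : HT_mor k k' T ->
  (forall f, in_HT k f -> in_HT k'' (T f)) -> HT_mor k k'' T.
Proof. by move=> [_ TL TD] Tin; split. Qed.

Lemma HT_mor_sub k k' : (forall i j, adj k' i j -> adj k i j) ->
  HT_mor k k' (@id F).
Proof.
move=> kk'; split=> // f /in_HTP Hf; apply/in_HTP => w i j ij.
exact: Hf (kk' _ _ ij).
Qed.

Lemma HT_mor_comp k k' k'' (T S : F -> F) :
  HT_mor k k' T -> HT_mor k' k'' S -> HT_mor k k'' (fun f => S (T f)).
Proof.
move=> TM SM; split=> [f Hf|p f g Hf Hg|s f Hf].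
- exact: (HT_mor_in SM (HT_mor_in TM Hf)).
- have Tf := HT_mor_in TM Hf; have Tg := HT_mor_in TM Hg.
  by rewrite (HT_mor_lin TM) // (HT_mor_lin SM).
- have Tf := HT_mor_in TM Hf.
  by rewrite (HT_mor_dot TM) // (HT_mor_dot SM).
Qed.

Lemma HT_morD k k' (T S : F -> F) :
  HT_mor k k' T -> HT_mor k k' S -> HT_mor k k' (fun f => T f + S f).
Proof.
move=> TM SM; split=> [f Hf|p f g Hf Hg|s f Hf].
- by apply: in_HTD; [exact: (HT_mor_in TM)|exact: (HT_mor_in SM)].
- rewrite (HT_mor_lin TM) // (HT_mor_lin SM) //.
  by apply/ffunP=> w; rewrite !ffunE; ring.
- rewrite (HT_mor_dot TM) // (HT_mor_dot SM) //.
  by rewrite linearD.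
Qed.

Lemma HT_morZ k k' (c : K) (T : F -> F) :
  HT_mor k k' T -> HT_mor k k' (fun f => c *: T f).
Proof.
move=> TM; split=> [f Hf|p f g Hf Hg|s f Hf].
- by apply: in_HTZ; exact: (HT_mor_in TM).
- rewrite (HT_mor_lin TM) // scalerDr; congr (_ + _).
  by apply/ffunP=> w; rewrite !ffunE scalerAr.
- by rewrite (HT_mor_dot TM) // linearZ.
Qed.

Lemma HT_mor_label k i j : HT_mor k k (fmul (label K i j)).
Proof.
split=> [f Hf|p f g _ _|s f _].
- by apply: in_HT_mul => //; apply: in_HT_label.
- by move: (label K i j) => u; apply/ffunP=> w; rewrite !ffunE; ring.
- by rewrite dot_mul dot_label.
Qed.

Variables (a b : 'I_n) (neq_ab : a != b).

Lemma HT_mor_refl_right k : twins a b k -> HT_mor k k (@refl_right K n a b).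
Proof.
move=> tk; split=> [f|p f g _ _|s f _]; first exact: in_HT_refl_right.
  by apply/ffunP=> w; rewrite !ffunE.
by apply/ffunP=> w; rewrite !ffunE mulgA.
Qed.

Lemma HT_mor_divdiff k : twins a b k -> adj k a b -> HT_mor k k (@divdiff K n a b).
Proof.
move=> tk kab; split=> [f|p f g|s f].
- exact: in_HT_divdiff.
- exact: divdiff_hlin.
- exact: divdiff_dot.
Qed.

End MorphismConstructions.

(** * The isomorphism for a modular triple of graphs *)

Definition is_edge n (x y i j : 'I_n) : bool := (i == x) && (j == y) || (i == y) && (j == x).

Section ModularTriple.
Variables (K : fieldType) (n : nat) (hm h hp : 'I_n -> 'I_n) (a b c : 'I_n).
Local Notation F := {ffun 'S_n -> {mpoly K[n]}}.
Implicit Types (f g x : F).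

(** The common shape of both kinds of modular triples. *)
Record modular_graphs : Prop := {
  mg_ab : adj hm a b;
  mg_twins : twins a b hm;
  mg_ca : c != a;
  mg_cb : c != b;
  mg_h : forall i j, adj h i j = adj hm i j || is_edge c a i j;
  mg_hp : forall i j, adj hp i j = adj h i j || is_edge c b i j }.

Hypothesis two_neq0 : (2%:R : K) != 0.
Hypothesis MG : modular_graphs.
Local Notation r := (tperm a b).
Local Notation alpha := (label K a b).
Local Notation beta := (label K a c).
Local Notation refl := (@refl_right K n a b).
Local Notation dd := (@divdiff K n a b).

Let neq_ab : a != b := adj_neq (mg_ab MG).

Lemma adj_hab : adj h a b.
Proof. by rewrite (mg_h MG) (mg_ab MG). Qed.

Lemma adj_hpab : adj hp a b.
Proof. by rewrite (mg_hp MG) adj_hab. Qed.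

Lemma twins_hp : twins a b hp.
Proof.
have rE (x y : 'I_n) : (r x == y) = (x == r y) by rewrite (can2_eq (tpermK a b) (tpermK a b)).
have rc : r c = c by rewrite tpermD // eq_sym ?(mg_ca MG) ?(mg_cb MG).
move=> i j; rewrite !(mg_hp MG) !(mg_h MG) (mg_twins MG) /is_edge !rE rc tpermL tpermR.
exact: orbAC.
Qed.

Lemma HT_mor_sub_hm : HT_mor h hm (@id F).
Proof. by apply: HT_mor_sub => i j; rewrite (mg_h MG) => ->. Qed.

Lemma HT_mor_sub_h : HT_mor hp h (@id F).
Proof. by apply: HT_mor_sub => i j; rewrite (mg_hp MG) => ->. Qed.

(** On the new edge {c, a} the factor beta is the label itself, so both sides
    of the congruence vanish. *)
Lemma in_HT_beta f : in_HT hm f -> in_HT h (fmul beta f).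
Proof.
move=> Hf; have /in_HTP Hbf := in_HT_mul (@in_HT_label K n hm a c) Hf.
apply/in_HTP=> w i j; rewrite (mg_h MG) => /orP[/Hbf //|].
move=> ij; rewrite /congr_at !ffunE !collapseM !collapseB !collapseXU !permM.
by case/orP: ij => /andP[/eqP-> /eqP->]; rewrite tpermL tpermR !eqxx ?(inj_eq perm_inj);
  case: eqP => _; rewrite ?subrr !mul0r.
Qed.

Lemma HT_mor_beta : HT_mor hm h (fmul beta).
Proof. exact: HT_mor_cod (HT_mor_label K hm a c) in_HT_beta. Qed.

(** The congruence along {c, b} at w is the one along {c, a} at w r. *)
Lemma in_HT_invariant f : in_HT h f -> refl f = f -> in_HT hp f.
Proof.
move=> /in_HTP Hf fr; apply/in_HTP=> w i j; rewrite (mg_hp MG) => /orP[/Hf //|].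
have fE (v : 'S_n) : f (r * v)%g = f v by rewrite -[in RHS]fr ffunE.
have hca : adj h c a by rewrite (mg_h MG) /is_edge !eqxx orbT.
have hac : adj h a c by rewrite adjC.
have rc : r c = c by rewrite tpermD // eq_sym ?(mg_ca MG) ?(mg_cb MG).
have tE (x y : 'I_n) (v : 'S_n) : f (tperm (r x) (r y) * v)%g = f (tperm x y * (r * v))%g.
  rewrite -[RHS]fE; congr (f _).
  by rewrite -tpermJ conjgE tpermV !mulgA.
case/orP=> /andP[/eqP-> /eqP->].
- have := Hf (r * w)%g c a hca; rewrite /congr_at !permM rc tpermL fE => ->.
  by rewrite -tE rc tpermL.
- have := Hf (r * w)%g a c hac; rewrite /congr_at !permM rc tpermL fE => ->.
  by rewrite -tE rc tpermL.
Qed.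

Lemma invariantE x w : refl x = x -> x (r * w)%g = x w.
Proof. by move=> xr; rewrite -[in RHS]xr ffunE. Qed.

Lemma divdiff_invariant k x : adj k a b -> in_HT k x -> refl x = x -> dd x = 0.
Proof.
move=> kab Hx xr; apply: (divdiff_uniq neq_ab kab Hx) => w.
by rewrite (invariantE _ xr) [(0 : F) w]ffunE mulr0 subrr.
Qed.

Lemma divdiff_alphaM k x : adj k a b -> in_HT k x -> refl x = x ->
  dd (fmul alpha x) = 2%:R *: x.
Proof.
move=> kab Hx xr; apply: (divdiff_uniq neq_ab kab) => [|w].
  exact: HT_mor_in (HT_mor_label K k a b) _ Hx.
rewrite 2![fmul alpha x _]ffunE alpha_r (invariantE _ xr) [(_ *: x) w]ffunE.
by rewrite scaler_nat; ring.
Qed.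

Lemma divdiff_betaM k x : adj k a b -> in_HT k x -> refl x = x ->
  dd (fmul beta x) = x.
Proof.
move=> kab Hx xr; apply: (divdiff_uniq neq_ab kab) => [|w].
  exact: HT_mor_in (HT_mor_label K k a c) _ Hx.
rewrite 2![fmul beta x _]ffunE (invariantE _ xr) !ffunE !permM tpermL.
by rewrite tpermD ?(eq_sym _ c) ?(mg_ca MG) ?(mg_cb MG) //; ring.
Qed.

Lemma refl_divdiff k f : adj k a b -> in_HT k f -> refl (dd f) = dd f.
Proof. by move=> kab Hf; apply/ffunP=> w; rewrite ffunE (divdiff_r neq_ab w kab Hf). Qed.

(** On the r-stable rings H_T(h_-) and H_T(h_+), [sym f] and alpha [halfdd f]
    are the parts of f in A and alpha A; on H_T(h), [invpart f] is the part of f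
    in the first summand of A_+ (+) beta A_-. *)
Definition sym f : F := 2%:R^-1 *: (f + refl f).
Definition invpart f : F := f + (- 1) *: fmul beta (dd f).
Definition halfdd f : F := 2%:R^-1 *: dd f.

Lemma half_double x : 2%:R^-1 *: (x + x) = x.
Proof. by rewrite -mulr2n -scaler_nat scalerA mulVf ?scale1r. Qed.

Lemma refl_sym f : refl (sym f) = sym f.
Proof.
apply/ffunP=> w; rewrite !ffunE mulgA tperm2 mul1g.
by rewrite addrC.
Qed.

Lemma refl_halfdd k f : adj k a b -> in_HT k f -> refl (halfdd f) = halfdd f.
Proof.
move=> kab Hf; have := refl_divdiff kab Hf.
rewrite /halfdd; move: (dd f) => u uE; rewrite -[in RHS]uE.
by apply/ffunP=> w; rewrite !ffunE.
Qed.

Lemma sym_invariant x : refl x = x -> sym x = x.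
Proof. by move=> xr; rewrite /sym xr half_double. Qed.

Lemma sym_alphaM x : refl x = x -> sym (fmul alpha x) = 0.
Proof.
move=> xr; rewrite /sym (_ : refl _ = - fmul alpha x) ?subrr ?scaler0 //.
apply/ffunP=> w; rewrite [LHS]ffunE [LHS]ffunE alpha_r (invariantE _ xr).
by rewrite [RHS]ffunE [fmul _ _ _]ffunE mulNr.
Qed.

Lemma sym_halfdd k f : adj k a b -> in_HT k f -> sym f + fmul alpha (halfdd f) = f.
Proof.
move=> kab Hf; rewrite -[RHS]half_double.
apply/ffunP=> w.
have hE : fmul alpha (halfdd f) w = 2%:R^-1 *: (f w - f (r * w)%g).
  by rewrite [LHS]ffunE [halfdd f w]ffunE -scalerAr (divdiffE w kab Hf).
rewrite [LHS]ffunE hE [sym f w]ffunE [(f + refl f) w]ffunE [refl f w]ffunE.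
rewrite -scalerDr [RHS]ffunE [(f + f) w]ffunE; congr (_ *: _); ring.
Qed.

(** Since beta r = beta - alpha and f r = f - alpha D f, the corrections
    cancel. *)
Lemma refl_invpart f : in_HT h f -> refl (invpart f) = invpart f.
Proof.
move=> Hf; apply/ffunP=> w; have := divdiffE w adj_hab Hf.
have := divdiff_r neq_ab w adj_hab Hf.
rewrite /invpart; move: (dd f) => u ur uE.
rewrite !ffunE ur !permM tpermL tpermD ?(eq_sym _ c) ?(mg_ca MG) ?(mg_cb MG) //.
have -> : f (r * w)%g = f w - alpha w * u w by rewrite uE opprB addrC subrK.
by rewrite !ffunE !scaleN1r; ring.
Qed.

Lemma HT_mor_invpart : HT_mor h hp invpart.
Proof.
have idh : HT_mor h h (@id F) by apply: HT_mor_sub.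
have ddm := HT_mor_comp HT_mor_sub_hm (HT_mor_divdiff K neq_ab (mg_twins MG) (mg_ab MG)).
have M : HT_mor h h invpart := HT_morD idh (HT_morZ (-1) (HT_mor_comp ddm HT_mor_beta)).
apply: (HT_mor_cod M) => f Hf.
apply: in_HT_invariant; [exact: (HT_mor_in M)|exact: refl_invpart].
Qed.

Lemma HT_mor_sym k : twins a b k -> HT_mor k k sym.
Proof.
move=> tk; apply: HT_morZ; apply: HT_morD (HT_mor_refl_right K tk).
exact: HT_mor_sub.
Qed.

Lemma hom_fD m f g : homog_fun m f -> homog_fun m g -> homog_fun m (f + g).
Proof. by move=> hf hg w; rewrite ffunE; apply: rpredD. Qed.

Lemma hom_fZ m (t : K) f : homog_fun m f -> homog_fun m (t *: f).
Proof. by move=> hf w; rewrite ffunE; apply: rpredZ. Qed.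

Lemma hom_divdiff k m f : adj k a b -> in_HT k f -> homog_fun m.+2 f -> homog_fun m (dd f).
Proof. by move=> kab Hf hf w; have := divdiff_lowered neq_ab kab Hf hf w. Qed.

(** In degrees 0 and 1 there is no room for the quotient by alpha, which is why
    the shifted summands may vanish there. *)
Lemma divdiff_low k m f : (m < 2)%N -> adj k a b -> in_HT k f -> homog_fun m f -> dd f = 0.
Proof.
move=> m2 kab Hf hf; apply/ffunP=> w; have := divdiff_lowered neq_ab kab Hf hf w.
by rewrite [RHS]ffunE; case: m m2 {hf} => [|[|//]] _ /eqP.
Qed.

Lemma hom_label_divdiff k i m f : adj k a b -> in_HT k f -> homog_fun m f ->
  homog_fun m (fmul (label K a i) (dd f)).
Proof.
case: (ltnP m 2) => [m2|m2] kab Hf hf.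
  move=> w; rewrite [fmul _ _ w]ffunE (divdiff_low m2 kab Hf hf) [(0 : F) w]ffunE mulr0.
  exact: dhomog0.
case: m m2 hf => [|[|m]] // _ hf; apply: hom_label.
exact: (hom_divdiff kab Hf hf).
Qed.

Lemma hom_sym m f : homog_fun m f -> homog_fun m (sym f).
Proof.
by move=> hf; apply: hom_fZ; apply: hom_fD => // w; rewrite ffunE; apply: hf.
Qed.

Lemma hom_invpart m f : in_HT h f -> homog_fun m f -> homog_fun m (invpart f).
Proof.
move=> Hf hf; apply: hom_fD => //; apply: hom_fZ.
exact: (hom_label_divdiff _ adj_hab).
Qed.

Lemma scale_halfdd x f : fmul x (halfdd f) = 2%:R^-1 *: fmul x (dd f).
Proof.
rewrite /halfdd; move: (dd f) => u; apply/ffunP=> w.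
by rewrite !ffunE -scalerAr.
Qed.

Lemma fmul_beta_invpart f : in_HT h f -> invpart f + fmul beta (dd f) = f.
Proof. by move=> Hf; rewrite /invpart scaleN1r subrK. Qed.

Let twm := mg_twins MG.
Let twp := twins_hp.
Let abm := mg_ab MG.
Let abp := adj_hpab.

(** The isomorphism in degrees at least 2, with the matrix (P, alpha P; D, alpha D)
    and the inverse (sym, beta sym; D / 2, beta D / 2). *)
Lemma modular_matrix_iso m : exists e : lin_iso
    (sn_sum (HG K h m.+2) (HG K h m)) (sn_sum (HG K hp m.+2) (HG K hm m)),
  forall s v, e (sn_act s v) = sn_act s (e v).
Proof.
pose T (i j : bool) f : F :=
  if i then (if j then invpart f else fmul alpha (invpart f))
  else (if j then dd f else fmul alpha (dd f)).
pose S (i j : bool) f : F :=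
  if i then (if j then sym f else fmul beta (sym f))
  else (if j then halfdd f else fmul beta (halfdd f)).
pose d (i : bool) := if i then m.+2 else m.
have ddh : HT_mor h hm dd := HT_mor_comp HT_mor_sub_hm (HT_mor_divdiff K neq_ab twm abm).
have ddp : HT_mor hp h dd := HT_mor_comp (HT_mor_divdiff K neq_ab twp abp) HT_mor_sub_h.
apply: (@HG_sum_iso _ _ (fun=> h) (fun i => if i then hp else hm) d d T S).
- case; case.
  + exact: HT_mor_invpart.
  + exact: HT_mor_comp HT_mor_invpart (HT_mor_label K hp a b).
  + exact: ddh.
  + exact: HT_mor_comp ddh (HT_mor_label K hm a b).
- case; case.
  + exact: HT_mor_comp (HT_mor_sym twp) HT_mor_sub_h.
  + exact: HT_mor_comp (HT_mor_sym twm) HT_mor_beta.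
  + exact: HT_morZ ddp.
  + exact: HT_mor_comp (HT_morZ _ (HT_mor_divdiff K neq_ab twm abm)) HT_mor_beta.
- case; case=> f Hf hf.
  + exact: hom_invpart.
  + by apply: hom_label; apply: hom_invpart.
  + exact: (hom_divdiff adj_hab Hf hf).
  + exact: (hom_label_divdiff _ adj_hab Hf hf).
- case; case=> f Hf hf.
  + exact: hom_sym.
  + by apply: hom_label; apply: hom_sym.
  + by apply: hom_fZ; apply: (hom_divdiff abp Hf hf).
  + by rewrite /S scale_halfdd; apply: hom_fZ; apply: (hom_label_divdiff _ abm Hf hf).
(* P f and D f are r-invariant, and f = P f + beta D f. *)
- move=> i j f Hf; have Pr := refl_invpart Hf.
  have HP : in_HT hp (invpart f) := HT_mor_in HT_mor_invpart Hf.
  have dr := refl_divdiff adj_hab Hf.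
  have Hd : in_HT hm (dd f) := HT_mor_in ddh Hf.
  case: i; case: j => /=.
  + by rewrite sym_invariant // sym_invariant // fmul_beta_invpart.
  + rewrite !sym_alphaM // add0r.
    by apply/ffunP=> w; rewrite [LHS]ffunE !(ffunE (fun=> 0)) mulr0.
  + rewrite scale_halfdd /halfdd (divdiff_invariant abp HP Pr).
    rewrite (divdiff_invariant abm Hd dr) scaler0 add0r.
    by apply/ffunP=> w; rewrite !ffunE mulr0 scaler0.
  + rewrite /halfdd (divdiff_alphaM abp HP Pr) (divdiff_alphaM abm Hd dr).
    by rewrite !scalerA mulVf // !scale1r fmul_beta_invpart.
(* On an r-invariant x, P x = x and P (beta x) = 0, whereas D x = 0 and
   D (beta x) = x; moreover g = sym g + alpha D g / 2. *)
- move=> i j f Hf; set k := (if j then hp else hm) in Hf.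
  have abk : adj k a b by rewrite /k; case: (j).
  have twk : twins a b k by rewrite /k; case: (j).
  have Sr := refl_sym f; have HS : in_HT k (sym f) := HT_mor_in (HT_mor_sym twk) Hf.
  have Dr := refl_halfdd abk Hf.
  have HD : in_HT k (halfdd f).
    exact: (HT_mor_in (HT_morZ 2%:R^-1 (HT_mor_divdiff K neq_ab twk abk)) Hf).
  have PI x : in_HT k x -> refl x = x -> invpart x = x.
    move=> Hx xr; rewrite /invpart (divdiff_invariant abk Hx xr).
    by apply/ffunP=> w; rewrite !ffunE mulr0 scaler0 addr0.
  have PB x : in_HT k x -> refl x = x -> invpart (fmul beta x) = 0.
    by move=> Hx xr; rewrite /invpart (divdiff_betaM abk Hx xr) scaleN1r subrr.
  have fmul0 u : fmul u 0 = 0 :> F by apply/ffunP=> w; rewrite !ffunE mulr0.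
  case: i; case: j @k Hf abk twk HS Dr HD PI PB => k Hf abk twk HS Dr HD PI PB /=.
  + by rewrite !PI // (sym_halfdd abk Hf).
  + by rewrite !PB // fmul0 addr0.
  + by rewrite (divdiff_invariant abk HS Sr) (divdiff_invariant abk HD Dr) fmul0 addr0.
  + by rewrite (divdiff_betaM abk HS Sr) (divdiff_betaM abk HD Dr) (sym_halfdd abk Hf).
Qed.

Lemma modular_low_iso m : (m < 2)%N -> exists e : lin_iso
    (sn_sum (HG K h m) (sn_zero K n)) (sn_sum (HG K hp m) (sn_zero K n)),
  forall s v, e (sn_act s v) = sn_act s (e v).
Proof.
move=> m2.
have PM := HT_mor_invpart.
have SM : HT_mor hp h sym := HT_mor_comp (HT_mor_sym twp) HT_mor_sub_h.
have Pm : has_deg h m m invpart by move=> f; apply: hom_invpart.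
have Sm : has_deg hp m m sym by move=> f _; apply: hom_sym.
pose u (v : sn_sum (HG K h m) (sn_zero K n)) : sn_sum (HG K hp m) (sn_zero K n) :=
  (HG_map hp m invpart v.1, v.2).
pose v (v : sn_sum (HG K hp m) (sn_zero K n)) : sn_sum (HG K h m) (sn_zero K n) :=
  (HG_map h m sym v.1, v.2).
have uK : cancel u v.
  case=> y z; rewrite /u /v /=; have [f fZ ->] := coh_class_surj y.
  rewrite (HG_map_class PM Pm) // (HG_map_class SM Sm) ?(HT_mor_pred PM Pm) //.
  have /HT_predP[Hf hf] := fZ.
  rewrite (sym_invariant (refl_invpart Hf)) /invpart (divdiff_low m2 adj_hab Hf hf).
  congr (coh_class _ _ _, _).
  by apply/ffunP=> w; rewrite !ffunE mulr0 scaler0 addr0.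
have vK : cancel v u.
  case=> y z; rewrite /u /v /=; have [f fZ ->] := coh_class_surj y.
  rewrite (HG_map_class SM Sm) // (HG_map_class PM Pm) ?(HT_mor_pred SM Sm) //.
  have /HT_predP[Hf hf] := fZ.
  have HS := HT_mor_in (HT_mor_sym twp) Hf.
  have sE := sym_halfdd abp Hf.
  have h0 : fmul alpha (halfdd f) = 0.
    rewrite /halfdd (divdiff_low m2 abp Hf hf).
    by apply/ffunP=> w; rewrite [LHS]ffunE [X in _ * X]ffunE !(ffunE (fun=> 0)) scaler0 mulr0.
  rewrite /invpart (divdiff_invariant abp HS (refl_sym f)).
  congr (coh_class _ _ _, _); rewrite -[RHS]sE h0 addr0.
  by apply/ffunP=> w; rewrite !ffunE mulr0 scaler0 addr0.
have uL : linear u.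
  move=> t [y1 z1] [y2 z2].
  exact: (congr2 pair (HG_map_linear PM Pm t y1 y2) (erefl (t *: z1 + z2))).
have [e eE] := lin_iso_of uL uK vK.
exists e => s [y z]; rewrite !eE.
exact: (congr2 pair (HG_map_act PM Pm s y) (erefl z)).
Qed.

Theorem modular_graded_iso :
  graded_iso (graded_sum (HG K h) (graded_shift2 (HG K h)))
             (graded_sum (HG K hp) (graded_shift2 (HG K hm))).
Proof.
suff iso m : exists e : lin_iso (graded_sum (HG K h) (graded_shift2 (HG K h)) m)
    (graded_sum (HG K hp) (graded_shift2 (HG K hm)) m),
    forall s v, e (sn_act s v) = sn_act s (e v).
  by exists (fun m => projT1 (cid (iso m))) => m; apply: (projT2 (cid (iso m))).
case: m => [|[|m]]; [exact: modular_low_iso|exact: modular_low_iso|].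
exact: modular_matrix_iso.
Qed.

End ModularTriple.

(** * Both kinds of modular triples of Hessenberg functions *)

Lemma is_edgeC n (x y i j : 'I_n) : is_edge x y i j = is_edge y x i j.
Proof. exact: orbC. Qed.

Lemma adj_incr n (k k' : 'I_n -> 'I_n) (x y : 'I_n) :
  (x < y)%N -> (forall j, j != x -> k' j = k j) -> k' x = y -> (k x).+1 = y :> nat ->
  forall i j, adj k' i j = adj k i j || is_edge x y i j.
Proof.
move=> xy kE k'x kx i j.
have ordE (u v : 'I_n) : (u == v) = (u == v :> nat) by [].
have le_k' (l l' : 'I_n) : (l <= k' l')%N = (l <= k l')%N || (l' == x) && (l == y).
  have [->|/kE ->] := eqVneq l' x; last by rewrite orbF.
  by rewrite k'x ordE -kx leq_eqVlt ltnS orbC.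
by rewrite /adj /is_edge !le_k' !ordE; lia.
Qed.

Section Triples.
Variables (n : nat) (h : hessenberg n) (hm hp : 'I_n -> 'I_n).

(** The vertices d and d + 1 have the same neighbours above since
    h(d) = h(d + 1), and the same neighbours below except d0, the only vertex
    whose value separates them. *)
Lemma modular_graphs_C (d0 d d1 : 'I_n) : triple_C_at hm h hp d0 d d1 ->
  modular_graphs hm h hp d d1 d0.
Proof.
case=> -[d0d d1E] [hd hV] hm0 hp0 hmp.
have hd0 : h d0 = d by apply/hV.
have d1hd : (d1 <= h d)%N by rewrite hd hess_ge.
have nd : (d == d0) = false by apply/eqP=> E; rewrite E ltnn in d0d.
have nd1 : (d1 == d0) = false by apply/eqP=> E; have := d0d; rewrite -E d1E; lia.
have [hmd hpd] := hmp d (negbT nd); have [hmd1 hpd1] := hmp d1 (negbT nd1).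
split.
- rewrite /adj hmd; apply/orP; right; apply/andP; split=> //; lia.
- apply: twinsP => j jd jd1; rewrite /adj hmd hmd1 -hd.
    have jdN : (j : nat) <> d by move=> E; case/eqP: jd; apply: val_inj.
    have jd1N : (j : nat) <> d1 by move=> E; case/eqP: jd1; apply: val_inj.
    have hmj : (hm j : nat) <> d.
      have [->|j0] := eqVneq j d0; first by rewrite hm0; lia.
      have [-> _] := hmp j j0 => E; case/eqP: j0; apply/hV; exact: val_inj.
    lia.
- by rewrite eq_sym nd.
- by rewrite eq_sym nd1.
- apply: (adj_incr d0d) => [j /hmp[-> _]//|//|]; rewrite hm0; lia.
- by apply: adj_incr => [|j /hmp[_ ->]|//|]; rewrite // ?hd0 d1E //; lia.
Qed.

(** The mirror image: d' and d' + 1 have the same neighbours below since d' is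
    not a value of h, and the same neighbours above except h(d' + 1), which
    exceeds h(d') by 1. *)
Lemma modular_graphs_R (d d1 : 'I_n) : triple_R_at hm h hp d d1 ->
  modular_graphs hm h hp d1 d (h d1).
Proof.
case=> d1E [hd hd1N] hV [hmd1 hmE] [hpd hpE].
have hd1 : (d1 < h d1)%N.
  rewrite ltn_neqAle hess_ge andbT; apply/eqP=> E; case: hd1N; exact: val_inj.
have nd : d != d1 by apply/eqP=> E; move: d1E; rewrite -E; lia.
have hmd : hm d = h d by apply: hmE.
split.
- rewrite /adj hmd hmd1; apply/orP; left; lia.
- apply: twinsP => j jd1 jd; rewrite /adj hmd hmd1 hmE //.
  have jdN : (j : nat) <> d by move=> E; case/eqP: jd; apply: val_inj.
  have jd1N : (j : nat) <> d1 by move=> E; case/eqP: jd1; apply: val_inj.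
  have hjN : (h j : nat) <> d by move=> E; case: (hV j); apply: val_inj.
  lia.
- by apply/eqP=> E; rewrite E ltnn in hd1.
- by apply/eqP=> E; move: hd1; rewrite E; lia.
- move=> i j; rewrite is_edgeC; move: i j.
  by apply: adj_incr => // [j /hmE->//|]; rewrite hmd1.
- move=> i j; rewrite is_edgeC; move: i j.
  have dc : (d < h d1)%N by lia.
  by apply: (adj_incr dc) => //; apply: ord_inj; rewrite hpd hd.
Qed.

End Triples.

(** * Traces on finite-dimensional spaces *)

Section FiniteDimension.
Variable K : fieldType.

Definition findim (V : lmodType K) : Prop :=
  exists N (e : {linear V -> 'rV[K]_N}), bijective e.

(** A matrix of maximal rank among those with rows in P: adjoining a vector of
    P outside its row space would raise the rank. *)
Lemma submod_rowspace N (P : 'rV[K]_N -> Prop) :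
  P 0 -> (forall t u v, P u -> P v -> P (t *: u + v)) ->
  exists A : 'M[K]_N, forall v, P v <-> (v <= A)%MS.
Proof.
move=> P0 PL; pose Q d := `[< exists2 A : 'M[K]_N, \rank A = d & forall v : 'rV_N, (v <= A)%MS -> P v >].
have Q0 : exists d, Q d.
  exists 0%N; apply/asboolP; exists 0; first by rewrite mxrank0.
  by move=> v; rewrite submx0 => /eqP->.
have QN d : Q d -> (d <= N)%N by move=> /asboolP[A <- _]; apply: rank_leq_row.
case: (ex_maxnP Q0 QN) => d /asboolP[A rA AP] dmax.
exists A => v; split=> [Pv|]; last exact: AP.
have /asboolP/dmax : exists2 B : 'M[K]_N, \rank B = \rank (A + v)%MS &
    forall u : 'rV_N, (u <= B)%MS -> P u.
  exists (A + v)%MS => // u /sub_addsmxP[[u1 u2] /= ->].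
  rewrite [u2]mx11_scalar mul_scalar_mx addrC; apply: PL => //.
  by apply: AP; apply: submxMl.
rewrite -rA => le_r; have /mxrank_leqif_sup [_ rE] := addsmxSl A v.
have : \rank A == \rank (A + v)%MS by rewrite eqn_leq le_r mxrankS ?addsmxSl.
by rewrite rE; apply: submx_trans; apply: addsmxSr.
Qed.

Lemma inj_surj_bij (A B : choiceType) (u : A -> B) :
  injective u -> (forall y, exists x, u x = y) -> bijective u.
Proof.
move=> uI uS; exists (fun y => projT1 (cid (uS y))) => x.
  by apply: uI; case: (cid _).
by case: (cid _).
Qed.

Lemma findim_inj (V : lmodType K) N (e : {linear V -> 'rV[K]_N}) :
  injective e -> findim V.
Proof.
move=> eI; have [|t u v [x <-] [y <-]|A AP] :=
  @submod_rowspace N (fun v => exists x, e x = v).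
- by exists 0; rewrite linear0.
- by exists (t *: x + y); rewrite linearP.
pose B := row_base A.
have eB x : (e x <= B)%MS by rewrite eq_row_base; apply/AP; exists x.
exists (\rank A).
have [|f fE] := @linear_pack K V 'rV[K]_(\rank A) (fun x => e x *m pinvmx B).
  by move=> t x y; rewrite linearP mulmxDl scalemxAl.
exists f; apply: inj_surj_bij => [x y|y].
  by rewrite !fE => /(congr1 (mulmx^~ B)); rewrite !mulmxKpV // => /eI.
have /AP[x xE] : (y *m B <= A)%MS by rewrite -(eq_row_base A) submxMl.
by exists x; rewrite fE xE mulmxKp // row_base_free.
Qed.

(** The cokernel matrix of the kernel provides coordinates on the image that do
    not depend on the lift. *)
Lemma findim_surj (V W : lmodType K) (s : V -> W) : linear s ->
  (forall y, exists x, s x = y) -> findim V -> findim W.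
Proof.
move=> sL sS [N [e eB]]; have [f fE] := linear_pack sL.
have eS x : exists v, e v = x by case: eB => g _ gK; exists (g x).
have eI : injective e := bij_inj eB.
have [||A AP] := @submod_rowspace N (fun x => exists2 v, e v = x & f v = 0).
- by exists 0; rewrite linear0.
- move=> t _ _ [x <- fx] [y <- fy]; exists (t *: x + y); first by rewrite linearP.
  by rewrite linearP fx fy scaler0 addr0.
have kerE v : (e v *m cokermx A == 0) = (f v == 0).
  rewrite -submxE; apply/idP/eqP => [/AP[u /eI -> //]|fv]; apply/AP; by exists v.
pose lift w := projT1 (cid (sS w)).
have liftK w : f (lift w) = w by rewrite fE /lift; case: (cid _).
pose u w := e (lift w) *m cokermx A.
have uP v w : f v = w -> u w = e v *m cokermx A.
  move=> vw; apply/eqP; rewrite -subr_eq0 -mulmxBl -linearB kerE.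
  by rewrite linearB liftK vw subrr.
have [|u' u'E] := @linear_pack K W 'rV[K]_N u.
  move=> t x y; rewrite (@uP (t *: lift x + lift y)) ?linearP ?liftK //.
  by rewrite mulmxDl scalemxAl.
apply: (@findim_inj W N u') => x y; rewrite !u'E => /eqP.
rewrite -subr_eq0 -mulmxBl -linearB kerE linearB !liftK subr_eq0.
by move/eqP.
Qed.

Lemma findim_endo (V : lmodType K) N (e : {linear V -> 'rV[K]_N}) (f : V -> V) :
  bijective e -> linear f -> exists M : 'M[K]_N, forall v, e (f v) = e v *m M.
Proof.
move=> [g eK gK] fL; have gL := can2_linear eK gK.
have [|u uE] := @linear_pack K 'rV[K]_N 'rV[K]_N (fun x => e (f (g x))).
  by move=> t x y; rewrite gL fL linearP.
by exists (lin1_mx u) => v; rewrite mul_rV_lin1 uE eK.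
Qed.

(** Two coordinate systems e and e' differ by mutually inverse, a priori
    rectangular, matrices P and Q; so tr M' = tr (Q M P) = tr M. *)
Lemma lmod_traceE (V : lmodType K) N (e : {linear V -> 'rV[K]_N}) (f : V -> V) M :
  bijective e -> (forall v, e (f v) = e v *m M) -> lmod_trace f = \tr M.
Proof.
move=> eB eM; rewrite /lmod_trace; apply: xget_unique => /=.
  by exists N, e, M.
move=> _ [N' [e' [M' [[g' eK' gK'] eM' ->]]]].
have [g eK gK] := eB; have gL := can2_linear eK gK.
have gL' := can2_linear eK' gK'.
have [|p pE] := @linear_pack K 'rV[K]_N 'rV[K]_N' (fun x => e' (g x)).
  by move=> t x y; rewrite gL linearP.
have [|q qE] := @linear_pack K 'rV[K]_N' 'rV[K]_N (fun x => e (g' x)).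
  by move=> t x y; rewrite gL' linearP.
pose P := lin1_mx p; pose Q := lin1_mx q.
have xP x : x *m P = e' (g x) by rewrite mul_rV_lin1 pE.
have xQ x : x *m Q = e (g' x) by rewrite mul_rV_lin1 qE.
have PQ : P *m Q = 1%:M.
  by apply/row_matrixP=> i; rewrite !rowE mulmxA xP xQ eK' gK mulmx1.
have MP : M *m P = P *m M'.
  apply/row_matrixP=> i; rewrite !rowE !mulmxA !xP -eM'.
  by rewrite -{1}[delta_mx 0 i]gK -eM eK.
have QP : Q *m P = 1%:M.
  by apply/row_matrixP=> i; rewrite !rowE mulmxA xQ xP eK gK' mulmx1.
by rewrite -[M']mul1mx -QP -mulmxA -MP mxtrace_mulC -mulmxA PQ mulmx1.
Qed.

Lemma lmod_trace_sum (V W : lmodType K) (f : V -> V) (g : W -> W) :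
  findim V -> findim W -> linear f -> linear g ->
  lmod_trace (fun x : V * W => (f x.1, g x.2)) = lmod_trace f + lmod_trace g.
Proof.
move=> [N1 [e1 B1]] [N2 [e2 B2]] fL gL.
have [M1 E1] := findim_endo B1 fL; have [M2 E2] := findim_endo B2 gL.
rewrite (lmod_traceE B1 E1) (lmod_traceE B2 E2) -(mxtrace_block M1 0 0 M2).
have [|e eE] := @linear_pack K (V * W)%type 'rV[K]_(N1 + N2)
    (fun x => row_mx (e1 x.1) (e2 x.2)).
  by move=> t x y; rewrite /= !linearP -add_row_mx scale_row_mx.
apply: (lmod_traceE (e := e)).
  have [g1 K1 G1] := B1; have [g2 K2 G2] := B2.
  exists (fun r => (g1 (lsubmx r), g2 (rsubmx r))) => [[x y]|r]; rewrite eE /=.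
    by rewrite row_mxKl row_mxKr K1 K2.
  by rewrite G1 G2 hsubmxK.
by move=> [x y]; rewrite !eE /= mul_row_block !mulmx0 addr0 add0r E1 E2.
Qed.

Lemma lin_iso_inv_linear (V W : lmodType K) (phi : lin_iso V W) :
  linear (lin_iso_inv phi).
Proof. exact: can2_linear (lin_isoK phi) (lin_iso_invK phi). Qed.

Lemma lmod_trace_iso (V W : lmodType K) (phi : lin_iso V W) (f : V -> V) (g : W -> W) :
  (forall v, phi (f v) = g (phi v)) -> lmod_trace f = lmod_trace g.
Proof.
move=> fg; rewrite /lmod_trace; congr xget; apply/seteqP; split=> t /=.
- move=> [N [e [M [eB eM ->]]]].
  have [|e' eE] := @linear_pack K W 'rV[K]_N (fun w => e (lin_iso_inv phi w)).
    by move=> s x y; rewrite lin_iso_inv_linear linearP.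
  exists N, e', M; split=> // [|w].
    apply: (@eq_bij _ _ (e \o lin_iso_inv phi)) => [|w]; last by rewrite eE.
    apply: bij_comp => //; exists phi; [exact: lin_iso_invK|exact: lin_isoK].
  rewrite !eE -eM; congr (e _); apply: (can_inj (lin_isoK phi)).
  by rewrite fg !lin_iso_invK.
- move=> [N [e [M [eB eM ->]]]].
  have [|e' eE] := @linear_pack K V 'rV[K]_N (fun v => e (phi v)).
    by move=> s x y; rewrite !linearP.
  exists N, e', M; split=> // [|v]; last by rewrite !eE fg eM.
  apply: (@eq_bij _ _ (e \o phi)) => [|w]; last by rewrite eE.
  by apply: bij_comp => //; exists (lin_iso_inv phi); [exact: lin_isoK|exact: lin_iso_invK].
Qed.

End FiniteDimension.

(** * The Frobenius characteristic and the modular law *)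

Section Frobenius.
Variables (K : fieldType) (n : nat).

Lemma ch_iso (V W : sn_module K n) (phi : lin_iso V W) :
  (forall s v, phi (sn_act s v) = sn_act s (phi v)) -> ch V = ch W.
Proof.
move=> phiA; rewrite /ch; congr (_ *: _); apply: eq_bigr => w _.
by rewrite (lmod_trace_iso (phiA w)).
Qed.

Lemma ch_sum (V W : sn_module K n) : findim V -> findim W ->
  ch (sn_sum V W) = ch V + ch W.
Proof.
move=> fV fW; rewrite /ch -scalerDr -big_split /=; congr (_ *: _).
apply: eq_bigr => w _; rewrite -scalerDl; congr (_ *: _).
exact: lmod_trace_sum (sn_act_linear w) (sn_act_linear w).
Qed.

Lemma findim_zero : findim (sn_zero K n).
Proof.
have [//|e eE] := @linear_pack K (sn_zero K n) 'rV[K]_0 id.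
by exists 0%N, e; exists id => x; rewrite eE.
Qed.

Lemma ch_zero : ch (sn_zero K n) = 0.
Proof.
rewrite /ch big1 ?scaler0 // => w _.
have [//|e eE] := @linear_pack K (sn_zero K n) 'rV[K]_0 id.
rewrite (@lmod_traceE _ _ 0 e _ 0) ?mxtrace0 ?scale0r //.
- by exists id => x; rewrite eE.
- by move=> v; apply/matrixP=> i [].
Qed.

(** A homogeneous function is determined by finitely many coefficients of its
    finitely many values. *)
Lemma findim_HG (k : 'I_n -> 'I_n) m : findim (HG K k m).
Proof.
pose Z := sub_of (HT_pred (K := K) k m : submodClosed _).
have ZP : findim Z.
  pose D := ('S_n * 'X_{1..n < m.+1})%type.
  have [|e eE] := @linear_pack K Z 'rV[K]_#|{: D}|
      (fun x => \row_(i < #|{: D}|) (sub_val x (enum_val i : D).1)@_(enum_val i : D).2).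
    move=> t x y; apply/rowP=> i; rewrite !mxE sub_val_linear !ffunE.
    by rewrite mcoeffD mcoeffZ.
  apply: (@findim_inj _ _ _ e) => x y; rewrite !eE => /rowP xy.
  apply: val_inj; apply/ffunP=> w; apply/mpolyP=> mm.
  have [mmm|mmm] := ltnP (mdeg mm) m.+1.
    have := xy (enum_rank ((w, BMultinom mmm) : D)); rewrite !mxE enum_rankK.
    by [].
  have no (z : Z) : (sub_val z w)@_mm = 0.
    have /HT_predP[_ hz] := valP z.
    apply: (dhomog_nemf_coeff (hz w)) => /=; rewrite /cohdeg gtn_eqF //.
    by rewrite (leq_trans mmm) // leq_pmull.
  by rewrite -![val _]/(sub_val _) !no.
apply: (@findim_surj _ Z _ (subquot_pi (ideal_pred k))) ZP.
- by move=> t x y; rewrite subquot_piD subquot_piZ.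
- by move=> y; exists (generic_quotient.repr y); apply: subquot_piK.
Qed.

Lemma qmulD (A : lmodType K) (p q : {poly K}) (F : nat -> A) i :
  qmul (p + q) F i = qmul p F i + qmul q F i.
Proof. by rewrite /qmul -big_split; apply: eq_bigr => j _; rewrite coefD scalerDl. Qed.

Lemma qmul1 (A : lmodType K) (F : nat -> A) i : qmul 1 F i = F i.
Proof.
rewrite /qmul big_ord_recl coef1 scale1r subn0 big1 ?addr0 // => j _.
by rewrite coef1 scale0r.
Qed.

Lemma qmulX (A : lmodType K) (F : nat -> A) i :
  qmul 'X F i = if i is i'.+1 then F i' else 0.
Proof.
rewrite /qmul big_ord_recl coefX scale0r add0r; case: i => [|i]; first by rewrite big_ord0.
rewrite big_ord_recl coefX scale1r /= /bump /= subSS subn0 big1 ?addr0 // => j _.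
by rewrite coefX /= /bump scale0r.
Qed.

Lemma q_frobenius_modular (h hm hp : 'I_n -> 'I_n) (F Fm Fp : nat -> symfun K n) :
  graded_iso (graded_sum (HG K h) (graded_shift2 (HG K h)))
             (graded_sum (HG K hp) (graded_shift2 (HG K hm))) ->
  F =1 q_frobenius (HG K h) -> Fm =1 q_frobenius (HG K hm) ->
  Fp =1 q_frobenius (HG K hp) ->
  qmul (1 + 'X) F = Fp + qmul 'X Fm.
Proof.
move=> [phi phiA] FE FmE FpE; apply: funext => i.
rewrite qmulD qmul1 -[RHS]/(Fp i + qmul 'X Fm i) !qmulX FE FpE.
case: i => [|i].
  rewrite !addr0; have := ch_iso (phiA 0%N); rewrite !ch_sum ?ch_zero ?addr0 //;
  by [exact: findim_HG|exact: findim_zero].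
rewrite FE FmE /q_frobenius mulnS; have := ch_iso (phiA (2 * i).+2).
by rewrite !ch_sum //; exact: findim_HG.
Qed.

Lemma q_frobenius_transport (V : nat -> lmodType K) (W : graded_sn_module K n)
    (phi : forall m, lin_iso (V m) (W m)) :
  q_frobenius (graded_transport phi) =1 q_frobenius W.
Proof.
move=> i; apply: (@ch_iso (graded_transport phi (2 * i)) (W (2 * i)%N) (phi _)).
by move=> s v; rewrite lin_iso_invK.
Qed.

End Frobenius.

Theorem corollary5p2 (R : realType) (n : nat) :
  (forall (h : hessenberg n) (hm hp : 'I_n -> 'I_n) (d0 d d1 : 'I_n),
      triple_C_at hm h hp d0 d d1 ->
      graded_iso
        (graded_sum (HG R[i] h) (graded_shift2 (HG R[i] h)))
        (graded_sum (HG R[i] hp) (graded_shift2 (HG R[i] hm))))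
  /\
  (forall (s : 'I_n -> R) (s_inj : injective s)
      (phi : forall (h : hessenberg n) (m : nat), lin_iso (HX s h m) (HG R[i] h m)),
    let F (h : hessenberg n) : nat -> symfun R[i] n :=
      q_frobenius (graded_transport (phi h)) in
    forall hm h hp : hessenberg n, modular_triple hm h hp ->
      qmul (1 + 'X) (F h) = F hp + qmul 'X (F hm)).
Proof.
have two : (2%:R : R[i]) != 0 by rewrite Num.Theory.pnatr_eq0.
split=> [h hm hp d0 d d1 /modular_graphs_C|s s_inj phi F hm h hp hT].
  exact: modular_graded_iso.
apply: (@q_frobenius_modular _ n h hm hp); try exact: q_frobenius_transport.
case: hT => [[d0 [d [d1 /modular_graphs_C]]]|[d [d1 /modular_graphs_R]]];
  exact: modular_graded_iso.
Qed.
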